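(* Let $D$ be a set, $F\subset B(D)$ convex and symmetric, and $\mathrm{APP}_\infty$ the identity on $B(D)$. Then for all $n\in\mathbb{N}$, \[ g_{2n-1}^{\mathrm{lin}}(\mathrm{APP}_\infty,F)\;\le\;6\,n\Big(\prod_{k=0}^{n-1} e_k^{\text{ran}}(\mathrm{APP}_\infty,F)\Big)^{1/n}. \] If moreover $F$ is the closed unit ball of a Hilbert space $H$ which is a linear subspace of $B(D)$ continuously embedded into $B(D)$, then $g_{4n-1}^{\mathrm{lin}}(\mathrm{APP}_\infty,F)\le 6\,n^{1/2}\big(\prod_{k=0}^{n-1} e_k^{\text{ran}}(\mathrm{APP}_\infty,F)\big)^{1/n}$.
   Context: $B(D)$ is the Banach space of bounded (real) functions on $D$ with the sup-norm. The linear sampling numbers are $g_n^{\mathrm{lin}}(\mathrm{APP}_\infty,F)=\inf_{x_1,\dots,x_n\in D,\ \phi_1,\dots,\phi_n\in B(D)}\sup_{f\in F}\|f-\sum_{i=1}^n f(x_i)\phi_i\|_{B(D)}$. A deterministic adaptive algorithm with $n$ measurements is a map $A_n=\phi\circ N_n\colon F\to Y$ ($Y=B(D)$) where $\phi\colon\mathbb{R}^n\to Y$ is arbitrary and $N_n(f)=(y_1,\dots,y_n)$ with $y_1=L_1(f)$, $y_k=L_k^{(y_1,\dots,y_{k-1})}(f)$, each $L_k^{(\cdot)}$ a continuous linear functional on $X=B(D)$ that may depend on the previous values. A randomized algorithm is a family $(A_n^\omega)_{\omega\in\Omega}$ of such algorithms indexed by a probability space such that $(f,\omega)\mapsto\|f-A_n^\omega(f)\|$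 is $\mathcal{B}_F\otimes\mathcal{A}$-measurable ($\mathcal{B}_F$ the Borel $\sigma$-algebra on $F$ of the seminorm with unit ball $F-F$); its error is $\sup_{f\in F}\mathbb{E}\|f-A_n^\omega(f)\|$. $e_n^{\text{ran}}(\mathrm{APP}_\infty,F)$ is the infimum of this error over all randomized algorithms with $n$ measurements (for $n=0$: constant outputs). *)

(* Defs.v *)
From HB Require Import structures.
From mathcomp Require Import all_boot all_order all_algebra.
From mathcomp Require Import all_classical all_reals all_analysis.
Set Implicit Arguments. Unset Strict Implicit. Unset Printing Implicit Defensive.
Import Order.TTheory GRing.Theory Num.Theory.
Import numFieldNormedType.Exports.
Local Open Scope classical_set_scope.
Local Open Scope ring_scope.

Definition BD (R : realType) (D : Type) : set (D -> R) :=
  [set f | exists M : R, forall x, `|f x| <= M].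

(* sup-norm (used only on bounded functions, D nonempty) *)
Definition supnorm {R : realType} {D : Type} (f : D -> R) : R :=
  sup (range (fun x => `|f x|)).

(* continuous linear functional on B(D) (sup-norm topology); only its
   values on B(D) matter *)
Definition clin_functional {R : realType} {D : Type} (L : (D -> R) -> R) : Prop :=
  (forall (a b : R) (f g : D -> R), @BD R D f -> @BD R D g ->
      L (fun x => a * f x + b * g x) = a * L f + b * L g) /\
  (forall f, @BD R D f -> forall eps : R, 0 < eps ->
     exists2 delta : R, 0 < delta &
       forall g, @BD R D g -> supnorm (fun x => g x - f x) < delta ->
         `|L g - L f| < eps).

Fixpoint info {R : realType} {D : Type}
  (L : nat -> seq R -> (D -> R) -> R) (f : D -> R) (k : nat) : seq R :=
  match k with
  | 0 => [::]
  | k'.+1 => let ys := info L f k' in rcons ys (L k' ys f)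
  end.

Definition det_alg {R : realType} {D : Type} (n : nat)
  (L : nat -> seq R -> (D -> R) -> R) (phi : seq R -> D -> R) : Prop :=
  (forall (k : nat) (ys : seq R), (k < n)%N -> size ys = k ->
      clin_functional (L k ys)) /\
  (forall ys : seq R, @BD R D (phi ys)).

Definition alg_out {R : realType} {D : Type} (n : nat)
  (L : nat -> seq R -> (D -> R) -> R) (phi : seq R -> D -> R) (f : D -> R) : D -> R :=
  phi (info L f n).

(* worst-case over F of a nonnegative quantity (sup of the empty set = 0) *)
Definition wc_err {R : realType} {D : Type} (F : set (D -> R))
  (e : (D -> R) -> \bar R) : \bar R :=
  ereal_sup ([set 0%E] `|` [set e f | f in F]).

Definition g_lin {R : realType} {D : Type} (F : set (D -> R)) (n : nat) : \bar R :=
  ereal_inf [set r | exists (x : 'I_n -> D) (phi : 'I_n -> D -> R),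
     (forall i, @BD R D (phi i)) /\
     r = wc_err F (fun f =>
           (supnorm (fun y => f y - \sum_(i < n) f (x i) * phi i y))%:E)].

Definition FmF {R : realType} {D : Type} (F : set (D -> R)) : set (D -> R) :=
  [set h | exists a b, F a /\ F b /\ h = (fun x => a x - b x)].

Definition pF {R : realType} {D : Type} (F : set (D -> R)) (h : D -> R) : R :=
  inf [set t : R | 0 < t /\ FmF F (fun x => t^-1 * h x)].

Definition openF {R : realType} {D : Type} (F : set (D -> R)) (U : set (D -> R)) : Prop :=
  U `<=` F /\
  forall f, U f -> exists2 e : R, 0 < e &
    forall g, F g -> pF F (fun x => g x - f x) < e -> U g.

Definition borelF {R : realType} {D : Type} (F : set (D -> R)) : set (set (D -> R)) :=
  <<s F, openF F >>.

Definition prod_sigma {R : realType} {D : Type} (F : set (D -> R))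
  {d} (Om : measurableType d) : set (set ((D -> R) * Om)) :=
  <<s F `*` setT,
      [set C | exists A B, borelF F A /\ measurable B /\ C = A `*` B] >>.

Definition rand_alg {R : realType} {D : Type} (F : set (D -> R)) (n : nat)
  {d} (Om : measurableType d)
  (L : Om -> nat -> seq R -> (D -> R) -> R) (phi : Om -> seq R -> D -> R) : Prop :=
  (forall w, det_alg n (L w) (phi w)) /\
  (forall S : set R, measurable S ->
     @prod_sigma R D F d Om ((F `*` setT) `&`
       [set p | S (supnorm (fun x => p.1 x - alg_out n (L p.2) (phi p.2) p.1 x))])).

Definition rand_err {R : realType} {D : Type} (F : set (D -> R)) (n : nat)
  {d} {Om : measurableType d} (P : probability Om R)
  (L : Om -> nat -> seq R -> (D -> R) -> R) (phi : Om -> seq R -> D -> R) : \bar R :=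
  wc_err F (fun f =>
    (\int[P]_w (supnorm (fun x => f x - alg_out n (L w) (phi w) f x))%:E)%E).

Definition e_ran {R : realType} {D : Type} (F : set (D -> R)) (n : nat) : \bar R :=
  ereal_inf [set r | exists (d : measure_display) (Om : measurableType d)
     (P : probability Om R) (L : Om -> nat -> seq R -> (D -> R) -> R)
     (phi : Om -> seq R -> D -> R),
     rand_alg F n L phi /\ r = rand_err F n P L phi].

Definition convexF {R : realType} {D : Type} (F : set (D -> R)) : Prop :=
  forall f g (t : R), F f -> F g -> 0 <= t <= 1 ->
    F (fun x => t * f x + (1 - t) * g x).

Definition symmetricF {R : realType} {D : Type} (F : set (D -> R)) : Prop :=
  forall f, F f -> F (fun x => - f x).

Definition hnorm {R : realType} {D : Type} (ip : (D -> R) -> (D -> R) -> R)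
  (f : D -> R) : R := Num.sqrt (ip f f).

Definition hilbert_emb {R : realType} {D : Type} (H : set (D -> R))
  (ip : (D -> R) -> (D -> R) -> R) : Prop :=
  H (fun _ => 0) /\
  (forall (a : R) f g, H f -> H g -> H (fun x => a * f x + g x)) /\
  H `<=` @BD R D /\
  (forall f g, H f -> H g -> ip f g = ip g f) /\
  (forall (a : R) f g h, H f -> H g -> H h ->
      ip (fun x => a * f x + g x) h = a * ip f h + ip g h) /\
  (forall f, H f -> 0 <= ip f f) /\
  (forall f, H f -> ip f f = 0 -> f = (fun _ => 0)) /\
  (forall u : nat -> D -> R, (forall k, H (u k)) ->
     (forall e : R, 0 < e -> exists N : nat, forall m k, (N <= m)%N -> (N <= k)%N ->
         hnorm ip (fun x => u m x - u k x) < e) ->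
     exists2 h, H h &
       (fun k => hnorm ip (fun x => u k x - h x)) @ \oo --> (0 : R)) /\
  (exists C : R, forall f, H f -> supnorm f <= C * hnorm ip f).

(* Main.v *)
Require Import Defs.
From HB Require Import structures.
From mathcomp Require Import all_boot all_order all_algebra.
From mathcomp Require Import all_classical all_reals all_analysis.
From mathcomp Require Import measurable_realfun zify ring lra.
Import Order.TTheory GRing.Theory Num.Theory.
Import numFieldNormedType.Exports.
Local Open Scope classical_set_scope.
Local Open Scope ring_scope.

(* Lower bound on e_k.  If F contains the image of the Euclidean unit ball of
   R^i under a linear map whose sup-norm dominates sigma times the Euclidean
   norm, draw the coefficients from a rotation invariant distribution on a
   spherical shell.  Each adaptive linear measurement can be rotated onto a
   coordinate, and a and -a are indistinguishable once the measured coordinates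
   are fixed; hence e_k >= sigma / 3 as soon as 2 k <= i.

   Upper bound on g.  For convex symmetric F, Hahn-Banach gives
   g_p <= sup {|f y| : f in F, f (x_j) = 0 for j < p}, so if t < g_N one finds
   points x_j and functions f_i in F whose matrix (f_i (x_j)) is triangular with
   diagonal at least t.  The lower bound yields a direction in which this matrix
   is shorter than a multiple of e_k; splitting it off and repeating bounds the
   determinant, hence t^(2n), by a product in which each e_k occurs twice.

   In the Hilbert case, f_i is chosen almost maximal at x_i among the functions
   of the unit ball vanishing at the previous points; this makes the f_i almost
   orthogonal, which saves a factor of order sqrt n. *)

(** * Iterated Lebesgue integrals *)

Section IteratedIntegral.
Context {R : realType}.

Local Notation leb := (@lebesgue_measure R).

(** Coordinates are prepended by [row_mx], so that products with block matrices can be computed by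
    [mul_row_block]. *)
Definition cons_rv n (x : R) (a : 'rV[R]_n) : 'rV[R]_n.+1 :=
  row_mx (x%:M : 'M[R]_1) a.

(** Stands for the integral over n-dimensional Lebesgue measure. Later inductions on the dimension
    fix the outermost variable, which is the first coordinate. *)
Fixpoint itint n : ('rV[R]_n -> \bar R) -> \bar R :=
  match n with
  | 0 => fun f => f 0
  | m.+1 => fun f => (\int[leb]_x itint m (fun a => f (cons_rv m x a)))%E
  end.

Definition rv_of n (t : n.-tuple R) : 'rV[R]_n := \row_i tnth t i.

(** Measurability refers to the product sigma-algebra on tuples, transported to row vectors by
    [rv_of]. Together with nonnegativity it is what Tonelli's theorem asks for. *)
Definition meas_ge0 n (f : 'rV[R]_n -> \bar R) :=
  measurable_fun setT (fun t : n.-tuple R => f (rv_of n t)) /\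
  (forall a, 0 <= f a)%E.

Lemma rv_of_cons n x (t : n.-tuple R) :
  rv_of n.+1 [tuple of x :: t] = cons_rv n x (rv_of n t).
Proof.
apply/rowP => i; rewrite !mxE; case: splitP => j ij.
- have -> : i = ord0 by apply/val_inj; rewrite /= ij; case: j ij => -[].
  by rewrite tnth0 ord1 mxE eqxx.
- have -> : i = lift ord0 j by apply/val_inj; rewrite /= ij.
  by rewrite tnthS mxE.
Qed.

Lemma rv_of0 (t : 0.-tuple R) : rv_of 0 t = 0.
Proof. by apply/rowP => -[]. Qed.

Lemma cons_rv_onto n (a : 'rV[R]_n.+1) : exists x b, a = cons_rv n x b.
Proof.
exists (lsubmx (a : 'rV_(1 + n)) 0 0), (rsubmx (a : 'rV_(1 + n))).
by rewrite /cons_rv -mx11_scalar hsubmxK.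
Qed.

(** Moves the first coordinate into the parameter space, which becomes [S * R]; this is the
    inductive step of the two Tonelli arguments below. *)
Lemma measurable_cons_rv n d (S : measurableType d) (f : S -> 'rV[R]_n.+1 -> \bar R) :
  measurable_fun setT (fun p : S * n.+1.-tuple R => f p.1 (rv_of n.+1 p.2)) ->
  measurable_fun setT
    (fun p : S * R * n.-tuple R => f p.1.1 (cons_rv n p.1.2 (rv_of n p.2))).
Proof.
move=> mf.
rewrite (_ : (fun _ => _) = (fun p : S * n.+1.-tuple R => f p.1 (rv_of n.+1 p.2))
   \o (fun p : S * R * n.-tuple R => (p.1.1, [tuple of p.1.2 :: p.2]))); last first.
  by apply/funext => p /=; rewrite -rv_of_cons.
apply: measurableT_comp => //; apply: measurable_fun_pair => /=.
  exact: measurableT_comp.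
by apply: measurable_cons => //; exact: measurableT_comp.
Qed.

Lemma itint_ge0 n (f : 'rV[R]_n -> \bar R) :
  (forall a, 0 <= f a)%E -> (0 <= itint n f)%E.
Proof.
elim: n f => [|n IH] f f0 /=; first exact: f0.
by apply: integral_ge0 => x _; exact: IH.
Qed.

(** Induction on [n] for all parameter spaces at once: the inner integral is measurable on [S * R],
    and Tonelli's theorem integrates out the factor [R]. *)
Lemma measurable_itint n d (S : measurableType d) (f : S -> 'rV[R]_n -> \bar R) :
  measurable_fun setT (fun p : S * n.-tuple R => f p.1 (rv_of n p.2)) ->
  (forall s a, 0 <= f s a)%E ->
  measurable_fun setT (fun s => itint n (f s)).
Proof.
elim: n d S f => [|n IH] d S f mf f0 /=.
  have := @measurableT_comp _ _ _ _ _ _ _ _ (fun s : S => (s, [tuple] : 0.-tuple R)) mf.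
  rewrite [X in _ -> measurable_fun _ X](_ : _ =
    (fun p : S * 0.-tuple R => f p.1 (rv_of 0 p.2)) \o (fun s : S => (s, [tuple]))).
    by apply; exact: measurable_fun_pair.
  by apply/funext => s /=; rewrite rv_of0.
have mF := IH _ (S * R)%type (fun p a => f p.1 (cons_rv n p.2 a))
  (measurable_cons_rv _ _ _ _ mf) (fun _ _ => f0 _ _).
have F0 (p : S * R) : (0 <= itint n (fun a => f p.1 (cons_rv n p.2 a)))%E.
  exact: itint_ge0.
exact: (@measurable_fun_fubini_tonelli_F _ _ S (measurableTypeR R) R leb _ mF F0).
Qed.

Lemma meas_ge0_section n f x : meas_ge0 n.+1 f -> meas_ge0 n (fun a => f (cons_rv n x a)).
Proof.
move=> [mf f0]; split => //.
rewrite (_ : (fun _ => _) = (fun t => f (rv_of n.+1 t))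
   \o (fun t : n.-tuple R => [tuple of x :: t])); last first.
  by apply/funext => t /=; rewrite -rv_of_cons.
apply: measurableT_comp => //; exact: measurable_cons.
Qed.

Lemma meas_ge0_itint n f : meas_ge0 n.+1 f ->
  measurable_fun setT (fun x => itint n (fun a => f (cons_rv n x a))).
Proof.
move=> [mf f0]; apply: (@measurable_itint _ _ _ (fun x a => f (cons_rv n x a))) => //.
rewrite (_ : (fun _ => _) = (fun t => f (rv_of n.+1 t))
   \o (fun p : R * n.-tuple R => [tuple of p.1 :: p.2])); last first.
  by apply/funext => t /=; rewrite -rv_of_cons.
apply: measurableT_comp => //; exact: measurable_cons.
Qed.

Lemma le_itint n f g : meas_ge0 n f -> meas_ge0 n g ->
  (forall a, f a <= g a)%E -> (itint n f <= itint n g)%E.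
Proof.
elim: n f g => [|n IH] f g mf mg fg /=; first exact: fg.
apply: ge0_le_integral => //.
- by move=> x _; apply: itint_ge0 => a; case: mf.
- exact: meas_ge0_itint.
- exact: meas_ge0_itint.
- by move=> x _; apply: IH => // ; exact: meas_ge0_section.
Qed.

Lemma eq_itint n f g : f =1 g -> itint n f = itint n g.
Proof. by move=> /funext ->. Qed.

Lemma itintD n f g : meas_ge0 n f -> meas_ge0 n g ->
  (itint n (fun a => f a + g a) = itint n f + itint n g)%E.
Proof.
elim: n f g => [//|n IH] f g mf mg /=.
rewrite -ge0_integralD //.
- apply: eq_integral => x _; apply: IH; exact: meas_ge0_section.
- by move=> x _; apply: itint_ge0 => a; case: mf.
- exact: meas_ge0_itint.
- by move=> x _; apply: itint_ge0 => a; case: mg.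
- exact: meas_ge0_itint.
Qed.

Lemma itintZ n (k : R) f : 0 <= k -> meas_ge0 n f ->
  (itint n (fun a => k%:E * f a) = k%:E * itint n f)%E.
Proof.
move=> k0; elim: n f => [//|n IH] f mf /=.
rewrite -ge0_integralZl //.
- apply: eq_integral => x _; apply: IH; exact: meas_ge0_section.
- exact: meas_ge0_itint.
- by move=> x _; apply: itint_ge0 => a; case: mf.
Qed.

Lemma meas_ge0D n f g : meas_ge0 n f -> meas_ge0 n g ->
  meas_ge0 n (fun a => f a + g a)%E.
Proof.
move=> [mf f0] [mg g0]; split; first exact: emeasurable_funD.
by move=> a; rewrite adde_ge0.
Qed.

Lemma meas_ge0Z n k f : 0 <= k -> meas_ge0 n f -> meas_ge0 n (fun a => k%:E * f a)%E.
Proof.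
move=> k0 [mf f0]; split; first exact: measurable_funeM.
by move=> a; rewrite mule_ge0 // lee_fin.
Qed.

Lemma itint_sum n I (r : seq I) (F : I -> 'rV[R]_n -> \bar R) :
  (forall i, meas_ge0 n (F i)) ->
  meas_ge0 n (fun a => \sum_(i <- r) F i a)%E /\
  (itint n (fun a => \sum_(i <- r) F i a) = \sum_(i <- r) itint n (F i))%E.
Proof.
move=> mF; elim: r => [|i r [IH1 IH2]].
  rewrite big_nil; split.
    split; last by move=> a; rewrite big_nil.
    apply: (eq_measurable_fun (cst 0%E)) => //.
    by move=> t _; rewrite /= big_nil.
  under eq_itint do rewrite big_nil.
  elim: n {F mF} => [//|n IH] /=.
  by rewrite integral0_eq.
have E : (fun a => \sum_(j <- i :: r) F j a)%E = (fun a => F i a + \sum_(j <- r) F j a)%E.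
  by apply/funext => a; rewrite big_cons.
rewrite E; split; first exact: meas_ge0D.
by rewrite itintD // IH2 big_cons.
Qed.

(** The integral over [P] is moved past one coordinate at a time. *)
Lemma itint_tonelli n d (S : measurableType d) (P : {sigma_finite_measure set S -> \bar R})
    (f : S -> 'rV[R]_n -> \bar R) :
  measurable_fun setT (fun p : S * n.-tuple R => f p.1 (rv_of n p.2)) ->
  (forall s a, 0 <= f s a)%E ->
  (\int[P]_s itint n (f s) = itint n (fun a => \int[P]_s f s a))%E.
Proof.
elim: n f => [//|n IH] f mf f0 /=.
have mf' := measurable_cons_rv _ _ _ _ mf.
rewrite (@fubini_tonelli _ _ S (measurableTypeR R) R P leb
   (fun p => itint n (fun a => f p.1 (cons_rv n p.2 a)))); last 2 first.
- exact: (@measurable_itint _ _ (S * R)%type (fun p a => f p.1 (cons_rv n p.2 a))).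
- by move=> p; exact: itint_ge0.
apply: eq_integral => x _; apply: (IH (fun s a => f s (cons_rv n x a))) => //.
apply: (@measurableT_comp _ _ _ _ _ _ _ _
  (fun p : S * n.-tuple R => ((p.1, x), p.2)) mf').
by do !apply: measurable_fun_pair => //=.
Qed.

(** The image of Lebesgue measure under [phi] agrees with it on half-open intervals, hence
    everywhere by uniqueness of Lebesgue measure. *)
Lemma integral_leb_comp (phi : measurableTypeR R -> measurableTypeR R)
    (f : R -> \bar R) :
  measurable_fun setT phi ->
  (forall a b : R, leb (phi @^-1` `]a, b]%classic) = leb `]a, b]%classic) ->
  measurable_fun setT f -> (forall x, 0 <= f x)%E ->
  (\int[leb]_x f (phi x) = \int[leb]_x f x)%E.
Proof.
move=> mphi phiE mf f0.
have := @ge0_integral_pushforward _ _ (measurableTypeR R) (measurableTypeR R) R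
  phi mphi leb setT f measurableT mf (fun y _ => f0 y).
rewrite preimage_setT => <-.
apply: eq_measure_integral => A mA _; apply/esym.
pose mphi_mixin := isMeasurableFun.Build _ _ _ _ _ mphi.
pose mphi_pack : {mfun _ >-> _} := HB.pack phi mphi_mixin.
apply: (@lebesgue_measure_unique R (pushforward leb mphi_pack)) => // _ [[a b]] _ <-.
by rewrite /pushforward /=; exact/esym/phiE.
Qed.

Lemma integral_leb_shift (c : R) (f : R -> \bar R) :
  measurable_fun setT f -> (forall x, 0 <= f x)%E ->
  (\int[leb]_x f (x + c)%R = \int[leb]_x f x)%E.
Proof.
move=> mf f0; apply: (integral_leb_comp (fun x => x + c)) => [|a b|//|//].
  by apply: measurable_funD.
rewrite (_ : _ @^-1` _ = `]a - c, b - c]%classic); last first.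
  by apply/seteqP; split => x /=; rewrite !in_itv /= ltrBlDr lerBrDr.
rewrite !lebesgue_measure_itv /= !lte_fin ltrBlDr subrK.
by case: ifP => // _; rewrite -!EFinD; congr EFin; ring.
Qed.

Lemma integral_leb_opp (f : R -> \bar R) :
  measurable_fun setT f -> (forall x, 0 <= f x)%E ->
  (\int[leb]_x f (- x)%R = \int[leb]_x f x)%E.
Proof.
move=> mf f0; apply: (integral_leb_comp (fun x => - x)) => [|a b|//|//].
  exact: oppr_measurable.
exact: (lebesgue_measureN (measurable_itv `]a, b])).
Qed.

(** * Shears and rotations of the plane *)

Definition meas2_ge0 (h : R * R -> \bar R) :=
  measurable_fun setT h /\ (forall p, 0 <= h p)%E.

Definition dintegral (h : R * R -> \bar R) := (\int[leb]_x \int[leb]_y h (x, y))%E.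

(** For fixed [x] the shear translates [y] by the constant [s * x]. *)
Lemma dintegral_shear_snd (h : R * R -> \bar R) (s : R) : meas2_ge0 h ->
  dintegral (fun p => h (p.1, p.2 + s * p.1)) = dintegral h.
Proof.
move=> [mh h0]; apply: eq_integral => x _ /=.
rewrite (integral_leb_shift (s * x) (fun y => h (x, y))) //.
exact: (measurable_fun_pair2 x mh).
Qed.

Lemma dintegralC (h : R * R -> \bar R) : meas2_ge0 h ->
  dintegral h = dintegral (fun p => h (p.2, p.1)).
Proof.
move=> [mh h0].
exact: (@fubini_tonelli _ _ (measurableTypeR R) (measurableTypeR R) R leb leb h).
Qed.

Lemma meas2_ge0_comp (h : R * R -> \bar R) (u v : R * R -> R) :
  measurable_fun setT u -> measurable_fun setT v -> meas2_ge0 h ->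
  meas2_ge0 (fun p => h (u p, v p)).
Proof.
move=> mu mv [mh h0]; split => //.
by apply: (measurableT_comp mh); apply: measurable_fun_pair.
Qed.

(** Exchanging the order of integration reduces this to the other shear. *)
Lemma dintegral_shear_fst (h : R * R -> \bar R) (t : R) : meas2_ge0 h ->
  dintegral (fun p => h (p.1 + t * p.2, p.2)) = dintegral h.
Proof.
move=> nh.
have nh' : meas2_ge0 (fun p => h (p.2, p.1)).
  by apply: meas2_ge0_comp.
apply: (etrans _ (esym (dintegralC h nh))).
apply: (etrans _ (dintegral_shear_snd _ t nh')); apply: dintegralC.
apply: meas2_ge0_comp => //.
by apply: measurable_funD => //; apply: measurable_funM.
Qed.

(* A rotation by an angle different from pi is a product of three shears. *)
Lemma dintegral_rot (h : R * R -> \bar R) (c s : R) : meas2_ge0 h ->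
  0 <= c -> c ^+ 2 + s ^+ 2 = 1 ->
  dintegral (fun p => h (c * p.1 - s * p.2, s * p.1 + c * p.2)) = dintegral h.
Proof.
(* For the angle with cosine [c] and sine [s], [t] is minus the tangent of half the angle; [0 <= c]
   keeps the denominator positive. *)
move=> nh c0 cs1; pose t := - (s / (1 + c)).
have c1 : 1 + c != 0 by rewrite gt_eqF // ltr_wpDr.
have st : s * t = c - 1.
  apply: (mulIf c1); rewrite /t mulrN mulNr mulrA divfK //.
  by have := cs1; rewrite !expr2 => ?; lra.
have tc : t * (1 + c) = - s by rewrite /t mulNr divfK.
have mlin (a b : R) : measurable_fun setT (fun p : R * R => a * p.1 + b * p.2).
  by apply: measurable_funD; apply: measurable_funM.
have mlin1 (b : R) : measurable_fun setT (fun p : R * R => p.1 + b * p.2).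
  by apply: measurable_funD => //; apply: measurable_funM.
have mlin2 (b : R) : measurable_fun setT (fun p : R * R => p.2 + b * p.1).
  by apply: measurable_funD => //; apply: measurable_funM.
apply: (etrans _ (dintegral_shear_fst h t nh)).
pose h1 (p : R * R) := h (p.1 + t * p.2, p.2).
have nh1 : meas2_ge0 h1 by exact: meas2_ge0_comp.
apply: (etrans _ (dintegral_shear_snd h1 s nh1)).
pose h2 (p : R * R) := h1 (p.1, p.2 + s * p.1).
have nh2 : meas2_ge0 h2 by exact: meas2_ge0_comp.
apply: (etrans _ (dintegral_shear_fst h2 t nh2)).
congr dintegral; apply/funext => -[x y]; rewrite /h2 /h1 /=; congr (h (_, _)).
  rewrite (_ : _ + t * _ = (1 + s * t) * x + t * (2 + s * t) * y); last by ring.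
  by rewrite st (_ : 2 + (c - 1) = 1 + c); [rewrite tc; ring | ring].
by rewrite (_ : y + _ = s * x + (1 + s * t) * y); [rewrite st; ring | ring].
Qed.

End IteratedIntegral.

(** * Rotations *)

Section Orthogonal.
Context {R : realType}.

Definition sqn n (a : 'rV[R]_n) : R := \sum_(i < n) a 0 i ^+ 2.

Lemma sqnE n (a : 'rV[R]_n) : sqn n a = (a *m a^T) 0 0.
Proof. by rewrite mxE; apply: eq_bigr => i _; rewrite mxE expr2. Qed.

Lemma sqn_ge0 n (a : 'rV[R]_n) : 0 <= sqn n a.
Proof. by apply: sumr_ge0 => i _; exact: sqr_ge0. Qed.

Lemma sqn_orth n (a : 'rV[R]_n) (Q : 'M[R]_n) : Q *m Q^T = 1%:M ->
  sqn n (a *m Q) = sqn n a.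
Proof.
by move=> QQ; rewrite !sqnE trmx_mul mulmxA -(mulmxA a) QQ mulmx1.
Qed.

Lemma sqnZ n k (a : 'rV[R]_n) : sqn n (k *: a) = k ^+ 2 * sqn n a.
Proof. by rewrite mulr_sumr; apply: eq_bigr => i _; rewrite mxE exprMn. Qed.

Lemma sqnN n (a : 'rV[R]_n) : sqn n (- a) = sqn n a.
Proof. by rewrite -scaleN1r sqnZ sqrrN expr1n mul1r. Qed.

Lemma sqn_delta n (i : 'I_n) : sqn n (delta_mx 0 i) = 1.
Proof.
rewrite /sqn (bigD1 i) //= big1 ?addr0; first by rewrite mxE !eqxx expr1n.
by move=> j ji; rewrite mxE eqxx (negbTE ji) expr0n.
Qed.

Lemma cons_rv_head n x (a : 'rV[R]_n) : cons_rv n x a 0 0 = x.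
Proof.
have := row_mxEl (x%:M : 'M[R]_1) a 0 0; rewrite [RHS]mxE eqxx => E.
apply: etrans E.
by congr (row_mx _ _ _ _); apply/val_inj.
Qed.

Lemma cons_rv_lift n x (a : 'rV[R]_n) i : cons_rv n x a 0 (lift ord0 i) = a 0 i.
Proof.
rewrite -(row_mxEr (x%:M : 'M[R]_1) a 0 i).
by congr (row_mx _ _ _ _); apply/val_inj.
Qed.

Lemma sqn_cons_rv n x (a : 'rV[R]_n) : sqn n.+1 (cons_rv n x a) = x ^+ 2 + sqn n a.
Proof.
rewrite /sqn big_ord_recl cons_rv_head; congr (_ + _).
by apply: eq_bigr => i _; rewrite cons_rv_lift.
Qed.

Lemma cons_rvN n x (a : 'rV[R]_n) : - cons_rv n x a = cons_rv n (- x) (- a).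
Proof.
apply/rowP => i; case: (unliftP ord0 i) => [j|] ->.
  by rewrite mxE !cons_rv_lift mxE.
by rewrite mxE !cons_rv_head.
Qed.

Lemma cons_rvZ n k x (a : 'rV[R]_n) : k *: cons_rv n x a = cons_rv n (k * x) (k *: a).
Proof.
apply/rowP => i; case: (unliftP ord0 i) => [j|] ->.
  by rewrite mxE !cons_rv_lift mxE.
by rewrite mxE !cons_rv_head.
Qed.

Lemma cons_rv00 n : cons_rv n 0 0 = 0 :> 'rV[R]_n.+1.
Proof.
apply/rowP => i; case: (unliftP ord0 i) => [j|] ->.
  by rewrite cons_rv_lift !mxE.
by rewrite cons_rv_head mxE.
Qed.

Lemma meas_ge0_lin n m (Q : 'M[R]_(n, m)) f : meas_ge0 m f ->
  meas_ge0 n (fun a => f (a *m Q)).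
Proof.
move=> [mf f0]; split => //.
rewrite (_ : (fun _ => _) = (fun t => f (rv_of m t)) \o
   (fun t : n.-tuple R => [tuple (rv_of n t *m Q) 0 i | i < m])); last first.
  apply/funext => t /=; congr f; apply/rowP => i.
  by rewrite [RHS]mxE tnth_mktuple.
apply: (measurableT_comp mf); apply/measurable_fun_tnthP => i.
rewrite (_ : _ \o _ = fun t : n.-tuple R => \sum_j tnth t j * Q j i).
  apply: measurable_sum => j; apply: measurable_funM => //.
  exact: measurable_tnth.
apply/funext => t /=; rewrite tnth_mktuple mxE.
by apply: eq_bigr => j _; rewrite mxE.
Qed.

Lemma meas_ge0N n f : meas_ge0 n f -> meas_ge0 n (fun a : 'rV[R]_n => f (- a)).
Proof.
move=> /(meas_ge0_lin n n (- 1%:M)).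
by under eq_fun do rewrite mulmxN mulmx1.
Qed.

Lemma itintN n f : meas_ge0 n f ->
  itint n (fun a : 'rV[R]_n => f (- a)) = itint n f.
Proof.
elim: n f => [|n IH] f mf /=; first by rewrite oppr0.
rewrite -[RHS]integral_leb_opp; last 2 first.
- exact: meas_ge0_itint.
- by move=> x; apply: itint_ge0 => a; case: mf.
apply: eq_integral => x _.
rewrite -(IH _ (meas_ge0_section _ _ (- x) mf)).
by apply: eq_itint => a; rewrite cons_rvN.
Qed.

(** Invariance of the integral is carried along with orthogonality: the matrices are products of
    plane rotations, for which invariance comes from shears. *)
Definition orth_inv n (Q : 'M[R]_n) : Prop :=
  Q *m Q^T = 1%:M /\
  forall f, meas_ge0 n f -> itint n (fun a => f (a *m Q)) = itint n f.

Lemma orth_inv1 n : orth_inv n 1%:M.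
Proof.
split; first by rewrite trmx1 mulmx1.
by move=> f _; apply: eq_itint => a; rewrite mulmx1.
Qed.

Lemma orth_invM n P Q : orth_inv n P -> orth_inv n Q -> orth_inv n (P *m Q).
Proof.
move=> [PP iP] [QQ iQ]; split.
  by rewrite trmx_mul mulmxA -(mulmxA P) QQ mulmx1.
move=> f mf; rewrite -(iQ f mf).
rewrite -(iP (fun a => f (a *m Q))); last exact: meas_ge0_lin.
by apply: eq_itint => a; rewrite mulmxA.
Qed.

Definition lift1_mx n (Q : 'M[R]_n) : 'M[R]_(1 + n) :=
  block_mx (1%:M : 'M[R]_1) 0 0 Q.

Lemma mul_lift1_mx n x (a : 'rV[R]_n) Q :
  cons_rv n x a *m lift1_mx n Q = cons_rv n x (a *m Q).
Proof.
rewrite /cons_rv; apply: (etrans (mul_row_block (x%:M : 'M[R]_1) a (1%:M : 'M[R]_1) 0 0 Q)).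
by rewrite !mulmx0 mulmx1 addr0 add0r.
Qed.

Lemma tr_lift1_mx n (Q : 'M[R]_n) : (lift1_mx n Q)^T = lift1_mx n Q^T.
Proof. by rewrite /lift1_mx tr_block_mx !trmx0 trmx1. Qed.

Lemma orth_inv_lift1 n (Q : 'M[R]_n) : orth_inv n Q -> orth_inv n.+1 (lift1_mx n Q).
Proof.
move=> [QQ iQ]; split.
  (* The identity is checked on each row of the unit matrix, written as a [cons_rv], where the
     action of the block matrix is known. *)
  apply/row_matrixP => i; rewrite tr_lift1_mx -[in LHS](mul1mx (lift1_mx n Q)).
  rewrite -mulmxA row_mul mulmxA.
  have [x [b ->]] := cons_rv_onto n (row i (1%:M : 'M[R]_n.+1)).
  by rewrite !mul_lift1_mx -mulmxA QQ mulmx1.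
move=> f mf /=; apply: eq_integral => x _.
rewrite -(iQ _ (meas_ge0_section _ _ x mf)).
by apply: eq_itint => a; rewrite mul_lift1_mx.
Qed.

(** Acting on row vectors from the right, it rotates the first two coordinates and fixes the
    others. *)
Definition givens n (c s : R) : 'M[R]_(1 + (1 + n)) :=
  block_mx (c%:M : 'M[R]_1) (row_mx (s%:M : 'M[R]_1) 0)
           (col_mx ((- s)%:M : 'M[R]_1) 0)
           (block_mx (c%:M : 'M[R]_1) 0 0 1%:M).

Lemma mul_givens n c s x y (a : 'rV[R]_n) :
  cons_rv n.+1 x (cons_rv n y a) *m givens n c s =
  cons_rv n.+1 (c * x - s * y) (cons_rv n (s * x + c * y) a).
Proof.
rewrite /cons_rv; apply: (etrans (mul_row_block (x%:M : 'M[R]_1) (row_mx (y%:M : 'M[R]_1) a)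
  (c%:M : 'M[R]_1) (row_mx (s%:M : 'M[R]_1) 0) (col_mx ((- s)%:M : 'M[R]_1) 0)
  (block_mx (c%:M : 'M[R]_1) 0 0 1%:M))).
rewrite mul_row_col mul_row_block mul_mx_row add_row_mx.
rewrite !mulmx0 !addr0 !add0r mulmx1 -!scalar_mxM -!raddfD /=.
by congr (row_mx (_%:M) (row_mx (_%:M) _)); ring.
Qed.

Lemma tr_givens n c s : (givens n c s)^T = givens n c (- s).
Proof.
rewrite /givens tr_block_mx tr_row_mx tr_col_mx tr_block_mx.
by rewrite !tr_scalar_mx !trmx0 opprK.
Qed.

Lemma orth_inv_givens n c s : 0 <= c -> c ^+ 2 + s ^+ 2 = 1 ->
  orth_inv n.+2 (givens n c s).
Proof.
move=> c0 cs1; split.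
  apply/row_matrixP => i; rewrite tr_givens -[in LHS](mul1mx (givens n c s)).
  rewrite -mulmxA row_mul mulmxA.
  have [x [b ->]] := cons_rv_onto n.+1 (row i (1%:M : 'M[R]_n.+2)).
  have [y [d ->]] := cons_rv_onto n b.
  have E z : z = (c ^+ 2 + s ^+ 2) * z by rewrite cs1 mul1r.
  rewrite !mul_givens [X in _ = cons_rv _ X _](E x) [X in _ = cons_rv _ _ (cons_rv _ X _)](E y).
  by congr (cons_rv _ _ (cons_rv _ _ _)); ring.
move=> f mf.
pose h (p : R * R) := itint n (fun a => f (cons_rv n.+1 p.1 (cons_rv n p.2 a))).
have nh : meas2_ge0 h.
  split; last by move=> p; apply: itint_ge0 => a; case: mf.
  apply: (@measurable_itint R n _ (R * R)%type
    (fun p a => f (cons_rv n.+1 p.1 (cons_rv n p.2 a)))); last first.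
    by move=> *; case: mf.
  rewrite (_ : (fun _ => _) = (fun t => f (rv_of n.+2 t))
     \o (fun p : R * R * n.-tuple R => [tuple of p.1.1 :: [tuple of p.1.2 :: p.2]])); last first.
    by apply/funext => t /=; rewrite -!rv_of_cons.
  apply: measurableT_comp; first by case: mf.
  apply: measurable_cons; first exact: measurableT_comp.
  by apply: measurable_cons => //; exact: measurableT_comp.
apply: etrans (dintegral_rot h c s nh c0 cs1).
apply: eq_integral => x _; apply: eq_integral => y _; apply: eq_itint => a.
by rewrite mul_givens.
Qed.

(** By induction the tail of [c] is rotated onto its own first coordinate; a Givens rotation of the
    first two coordinates then removes that remaining entry. *)
Lemma orth_inv_exists n (c : 'rV[R]_n.+1) :
  exists Q kappa, orth_inv n.+1 Q /\ c *m Q^T = kappa *: delta_mx 0 0.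
Proof.
elim: n c => [|n IH] c.
  exists 1%:M, (c 0 0); split; first exact: orth_inv1.
  rewrite trmx1 mulmx1; apply/rowP => i.
  by rewrite !mxE (ord1 i) !eqxx mulr1.
have [x [b ->]] := cons_rv_onto n.+1 c.
have [Q [k [iQ Qk]]] := IH b.
have e0E m : delta_mx 0 0 = cons_rv m 1 0 :> 'rV[R]_m.+1.
  apply/rowP => i; rewrite mxE eqxx /=.
  by case: (unliftP ord0 i) => [j|] ->; rewrite ?cons_rv_lift ?cons_rv_head ?eqxx ?mxE.
pose r := Num.sqrt (x ^+ 2 + k ^+ 2).
(* The rotation must send [(x, k)] onto the first axis with nonnegative cosine, as the factorization
   into shears requires; so the cosine is [|x| / r], and the sign of [x] goes into [s]. For [r = 0]
   the identity serves. *)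
have [co [s [co0 cs1 sx]]] : exists co s : R,
    [/\ 0 <= co, co ^+ 2 + s ^+ 2 = 1 & - s * x + co * k = 0].
  have r20 : 0 <= x ^+ 2 + k ^+ 2 by rewrite addr_ge0 // sqr_ge0.
  have [r0|r0] := eqVneq r 0.
    exists 1, 0; rewrite ler01 expr1n expr0n addr0; split => //.
    move/eqP: r0; rewrite sqrtr_eq0 => r0.
    have := sqr_ge0 x; have := sqr_ge0 k => k0 x0.
    have /eqP : k ^+ 2 = 0 by lra.
    by rewrite sqrf_eq0 => /eqP ->; rewrite oppr0 mul0r mulr0 addr0.
  have rr : r ^+ 2 = x ^+ 2 + k ^+ 2 by rewrite sqr_sqrtr.
  exists (`|x| / r), ((if x < 0 then - k else k) / r); split.
  - by rewrite divr_ge0 // sqrtr_ge0.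
  - rewrite !exprMn real_normK ?num_real // exprVn.
    rewrite (_ : (if _ then _ else _) ^+ 2 = k ^+ 2); last first.
      by case: ifP; rewrite // sqrrN.
    by rewrite -mulrDl -rr divff // sqrf_eq0.
  - by case: ltrP => x0; [rewrite ltr0_norm | rewrite ger0_norm] => //; field.
exists (givens n co s *m lift1_mx n.+1 Q), (co * x + s * k); split.
  by apply: orth_invM; [exact: orth_inv_givens | exact: orth_inv_lift1].
rewrite trmx_mul mulmxA.
rewrite tr_lift1_mx mul_lift1_mx Qk e0E cons_rvZ scaler0 mulr1 tr_givens mul_givens sx.
by rewrite e0E cons_rvZ mulr1 scaler0 mulNr opprK cons_rv00.
Qed.

End Orthogonal.

(** * Spherical shells *)

Section Radial.
Context {R : realType}.
Local Notation leb := (@lebesgue_measure R).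

Lemma meas_ge0_EFin n (f : 'rV[R]_n -> R) :
  measurable_fun setT (fun t : n.-tuple R => f (rv_of n t)) ->
  (forall a, 0 <= f a) -> meas_ge0 n (fun a => (f a)%:E).
Proof. by move=> mf f0; split; [exact/measurable_EFinP | move=> a; rewrite lee_fin]. Qed.

Lemma measurable_coord n (i : 'I_n) :
  measurable_fun setT (fun t : n.-tuple R => rv_of n t 0 i).
Proof. by under eq_fun do rewrite mxE; exact: measurable_tnth. Qed.

Lemma measurable_sqsum n (P : pred 'I_n) :
  measurable_fun setT (fun t : n.-tuple R => \sum_(i < n | P i) rv_of n t 0 i ^+ 2).
Proof.
under eq_fun do rewrite big_mkcond.
apply: measurable_sum => i; case: (P i); last exact: measurable_cst.
apply: measurable_funX; exact: measurable_coord.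
Qed.

Lemma measurable_radial n (w : R -> R) : measurable_fun setT w ->
  measurable_fun setT (fun t : n.-tuple R => w (sqn n (rv_of n t))).
Proof. by move=> mw; apply: measurableT_comp => //; exact: measurable_sqsum. Qed.

(** It is applied to [sqn n a], so [l] and [r] bound the squared radius. *)
Definition shell (l r s : R) : R := \1_(`[l, r]%classic) s.

Lemma shellE l r s : shell l r s = (l <= s <= r)%R%:R.
Proof.
rewrite /shell indicE; congr (nat_of_bool _)%:R.
by apply/idP/idP; rewrite inE /= in_itv.
Qed.

Lemma shell_ge0 l r s : 0 <= shell l r s.
Proof. by rewrite shellE ler0n. Qed.

Lemma measurable_shell l r : measurable_fun setT (shell l r).
Proof. exact: measurable_indic. Qed.

Lemma meas_ge0_shell n l r : meas_ge0 n (fun a => (shell l r (sqn n a))%:E).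
Proof.
apply: meas_ge0_EFin => [|a]; last exact: shell_ge0.
by apply: measurable_radial; exact: measurable_shell.
Qed.

Lemma integral_shell l r : l <= r -> (\int[leb]_x (shell l r x)%:E = (r - l)%:E)%E.
Proof.
move=> lr; rewrite integral_indic // setIT.
apply: (etrans (lebesgue_measure_itv `[l, r])); rewrite /= lte_fin.
by case: ltgtP lr => // -> _; rewrite subrr.
Qed.

(** The unit ball lies in the product of [[-1, 1]] and the unit ball of one dimension less. *)
Lemma itint_shell_lt_pinfty n : (itint n (fun a => (shell 0 1 (sqn n a))%:E) < +oo)%E.
Proof.
elim: n => [|n IH]; first by rewrite /= ltry.
set V := itint n _ in IH.
have V0 : (0 <= V)%E by apply: itint_ge0 => a; rewrite lee_fin shell_ge0.
have mV : measurable_fun setT (fun x : R => V * (shell (-1) 1 x)%:E)%E.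
  by apply: measurable_funeM; apply/measurable_EFinP; exact: measurable_shell.
apply: (@le_lt_trans _ _ (\int[leb]_x (V * (shell (-1) 1 x)%:E))%E).
  apply: ge0_le_integral => //.
  - by move=> x _; apply: itint_ge0 => a; rewrite lee_fin shell_ge0.
  - exact: (meas_ge0_itint _ _ (meas_ge0_shell n.+1 0 1)).
  - move=> x _; rewrite muleC -itintZ ?shell_ge0 //; last exact: meas_ge0_shell.
    apply: le_itint.
    + exact: (meas_ge0_section _ _ _ (meas_ge0_shell n.+1 0 1)).
    + by apply: meas_ge0Z; [exact: shell_ge0 | exact: meas_ge0_shell].
    + move=> a; rewrite -EFinM lee_fin sqn_cons_rv !shellE.
      have a0 := sqn_ge0 n a; have x0 := sqr_ge0 x.
      case: (boolP (0 <= _ <= 1)) => [/andP[_ H]|_]; last by rewrite mulr_ge0.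
      have -> : 0 <= sqn n a <= 1 by rewrite a0 /=; lra.
      have -> // : -1 <= x <= 1; last by rewrite mulr1.
      rewrite -ler_norml -[leRHS](@expr1n _ 2) -(@ler_pXn2r _ 2) ?nnegrE //.
      by rewrite real_normK ?num_real // expr1n; lra.
rewrite ge0_integralZl //; last by move=> x _; rewrite lee_fin shell_ge0.
  rewrite integral_shell; last by lra.
  by apply: lte_mul_pinfty; rewrite ?ltry // ge0_fin_numE.
by apply/measurable_EFinP; exact: measurable_shell.
Qed.

(** By induction: the shell contains the product of an interval of positive length and a thinner
    shell of one dimension less. *)
Lemma itint_shell_gt0 n (l r : R) : 0 <= l -> l < r ->
  (0 < itint n.+1 (fun a => (shell l r (sqn n.+1 a))%:E))%E.
Proof.
elim: n l r => [|n IH] l r l0 lr.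
  apply: (@lt_le_trans _ _ (\int[leb]_x (shell (Num.sqrt l) (Num.sqrt r) x)%:E)%E).
    rewrite integral_shell; last exact/ler_wsqrtr/ltW.
    by rewrite lte_fin subr_gt0 ltr_sqrt //; lra.
  apply: ge0_le_integral => //.
  - by move=> x _; rewrite lee_fin shell_ge0.
  - by apply/measurable_EFinP; exact: measurable_shell.
  - exact: (meas_ge0_itint _ _ (meas_ge0_shell 1 l r)).
  - move=> x _; rewrite lee_fin sqn_cons_rv /sqn big_ord0 addr0 !shellE.
    case: (boolP (Num.sqrt l <= _ <= _)) => [/andP[H1 H2]|_]; last by rewrite ler0n.
    have x0 : 0 <= x by apply: le_trans H1; exact: sqrtr_ge0.
    have -> // : l <= x ^+ 2 <= r.
    apply/andP; split; first by rewrite -[leLHS](sqr_sqrtr l0) ler_pXn2r ?nnegrE ?sqrtr_ge0.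
    rewrite -[leRHS](@sqr_sqrtr _ r); last by lra.
    by rewrite ler_pXn2r ?nnegrE ?sqrtr_ge0.
(* The thinner shell is [[l, m]]; since [m + d ^+ 2 = r], adding a coordinate from [[0, d]] keeps
   the squared radius within [[l, r]]. *)
pose m := (l + r) / 2; pose d := Num.sqrt (m - l).
have lm : l < m by rewrite /m; lra.
have d0 : 0 < d by rewrite sqrtr_gt0; lra.
have d2 : d ^+ 2 = m - l by rewrite sqr_sqrtr //; lra.
have V0 := IH l m l0 lm; set V := itint _ _ in V0.
have mV : measurable_fun setT (fun x : R => V * (shell 0 d x)%:E)%E.
  by apply: measurable_funeM; apply/measurable_EFinP; exact: measurable_shell.
apply: (@lt_le_trans _ _ (\int[leb]_x (V * (shell 0 d x)%:E))%E).
  rewrite ge0_integralZl // ?ltW //; last 2 first.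
  - by apply/measurable_EFinP; exact: measurable_shell.
  - by move=> x _; rewrite lee_fin shell_ge0.
  by rewrite integral_shell ?subr0 ?mule_gt0 ?lte_fin // ltW.
apply: ge0_le_integral => //.
- by move=> x _; rewrite mule_ge0 ?lee_fin ?shell_ge0 // ltW.
- exact: (meas_ge0_itint _ _ (meas_ge0_shell n.+2 l r)).
- move=> x _; rewrite muleC -itintZ ?shell_ge0 //; last exact: meas_ge0_shell.
  apply: (@le_itint _ n.+1 _ (fun a => (shell l r (sqn n.+2 (cons_rv n.+1 x a)))%:E)).
  + by apply: meas_ge0Z; [exact: shell_ge0 | exact: meas_ge0_shell].
  + exact: (meas_ge0_section _ _ _ (meas_ge0_shell n.+2 l r)).
  + move=> a; rewrite -EFinM lee_fin sqn_cons_rv !shellE.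
    case: (boolP (0 <= _ <= d)) => [/andP[x0 xd]|_]; last by rewrite mul0r ler0n.
    case: (boolP (l <= _ <= m)) => [/andP[H1 H2]|_]; last by rewrite mulr0 ler0n.
    have xd2 : x ^+ 2 <= d ^+ 2 by rewrite ler_pXn2r ?nnegrE // ltW.
    have x20 := sqr_ge0 x.
    by have -> : l <= x ^+ 2 + sqn n.+1 a <= r; rewrite ?mulr1 // /m in H2 d2 *; lra.
Qed.

(** Some rotation takes the i-th unit vector to plus or minus the first one, and a radial weight is
    unchanged by it. *)
Lemma itint_coord n (w : R -> R) (i : 'I_n.+1) : measurable_fun setT w -> (forall s, 0 <= w s) ->
  itint n.+1 (fun a => (w (sqn n.+1 a) * a 0 i ^+ 2)%:E) =
  itint n.+1 (fun a => (w (sqn n.+1 a) * a 0 0 ^+ 2)%:E).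
Proof.
move=> mw w0; have [Q [k [[QQ iQ] Qk]]] := orth_inv_exists n (delta_mx 0 i : 'rV[R]_n.+1).
have QQ' : Q^T *m Q = 1%:M by exact: mulmx1C.
have k1 : k ^+ 2 = 1.
  have := sqn_orth _ (delta_mx 0 i : 'rV[R]_n.+1) Q^T.
  by rewrite trmxK QQ' Qk sqnZ !sqn_delta mulr1; exact.
rewrite -iQ; last first.
  apply: meas_ge0_EFin => [|a]; last by rewrite mulr_ge0 ?sqr_ge0.
  apply: measurable_funM; first exact: measurable_radial.
  by apply: measurable_funX; exact: measurable_coord.
apply: eq_itint => a; rewrite sqn_orth //; congr (_ * _)%:E.
suff -> : (a *m Q) 0 i = k * a 0 0 by rewrite exprMn k1 mul1r.
have -> : (a *m Q) 0 i = (a *m ((delta_mx 0 i : 'rV[R]_n.+1) *m Q^T)^T) 0 0.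
  rewrite trmx_mul trmxK mulmxA [RHS]mxE (bigD1 i) //= big1 => [|j ji].
    by rewrite !mxE !eqxx mulr1 addr0.
  by rewrite !mxE eqxx (negbTE ji) mulr0.
rewrite Qk mxE (bigD1 0) //= big1 => [|j j0].
  by rewrite !mxE !eqxx mulr1 addr0 mulrC.
by rewrite !mxE eqxx (negbTE j0) !mulr0.
Qed.

(** By rotation invariance every coordinate has the same second moment [J]. On the shell all squares
    add up to at least [2 / 3], and at least half of the coordinates have index at least [k]; this
    gives the factor [1 / 3]. *)
Lemma itint_shell_tail n k : (2 * k <= n.+1)%N ->
  ((3^-1)%:E * itint n.+1 (fun a => (shell (2 / 3) 1 (sqn n.+1 a))%:E) <=
   itint n.+1 (fun a => (shell (2 / 3) 1 (sqn n.+1 a) *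
      \sum_(i < n.+1 | (k <= i)%N) a 0%R i ^+ 2)%:E))%E.
Proof.
move=> kn; set w := shell (2 / 3) 1; set W := itint _ _.
have mw : measurable_fun setT w by exact: measurable_shell.
have w0 s : 0 <= w s by exact: shell_ge0.
have mwi i : meas_ge0 n.+1 (fun a => (w (sqn n.+1 a) * a 0 i ^+ 2)%:E).
  apply: meas_ge0_EFin => [|a]; last by rewrite mulr_ge0 ?sqr_ge0.
  apply: measurable_funM; first exact: measurable_radial.
  by apply: measurable_funX; exact: measurable_coord.
pose J := itint n.+1 (fun a => (w (sqn n.+1 a) * a 0 0 ^+ 2)%:E).
have sumJ (P : pred 'I_n.+1) :
  itint n.+1 (fun a => (w (sqn n.+1 a) * \sum_(i < n.+1 | P i) a 0%R i ^+ 2)%:E) =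
  (\sum_(i < n.+1 | P i) J)%E.
  rewrite -big_filter.
  have [_ E] := itint_sum n.+1 _ [seq i <- index_enum 'I_n.+1 | P i] _ mwi.
  rewrite (eq_bigr (fun i => itint n.+1 (fun a => (w (sqn n.+1 a) * a 0 i ^+ 2)%:E))).
    rewrite -E; apply: eq_itint => a.
    by rewrite -big_filter mulr_sumr sumEFin.
  by move=> i _; rewrite itint_coord.
have J0 : (0 <= J)%E by apply: itint_ge0 => a; rewrite lee_fin mulr_ge0 ?sqr_ge0.
have Jfin : (J < +oo)%E.
  apply: le_lt_trans (itint_shell_lt_pinfty n.+1).
  apply: le_itint => //; first exact: meas_ge0_shell.
  move=> a; rewrite lee_fin /w !shellE.
  have a0 : a 0 0 ^+ 2 <= sqn n.+1 a.
    rewrite /sqn big_ord_recl lerDl; apply: sumr_ge0 => i _; exact: sqr_ge0.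
  have a1 := sqr_ge0 (a 0 0).
  case: (boolP (2 / 3 <= _ <= 1)) => [/andP[H1 H2]|_]; last by rewrite mul0r ler0n.
  by have -> : 0 <= sqn n.+1 a <= 1; [lra | rewrite mul1r; exact: le_trans a0 H2].
have [j Jj] : exists j, J = j%:E.
  by exists (fine J); rewrite fineK // ge0_fin_numE.
rewrite sumJ Jj sumEFin.
have WJ : ((2 / 3)%:E * W <= (\sum_(i < n.+1) j)%:E)%E.
  rewrite -sumEFin -Jj -(sumJ xpredT) -itintZ; last 2 first.
  - by lra.
  - exact: meas_ge0_shell.
  apply: le_itint.
  - by apply: meas_ge0Z; [lra | exact: meas_ge0_shell].
  - apply: meas_ge0_EFin => [|a]; last by rewrite mulr_ge0 ?sqn_ge0.
    by apply: measurable_funM; [exact: measurable_radial | exact: measurable_sqsum].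
  - move=> a; rewrite -EFinM lee_fin -/(sqn n.+1 a) /w shellE.
    case: (boolP (2 / 3 <= _ <= 1)) => [/andP[H1 H2]|_]; last by rewrite mulr0 mul0r.
    by rewrite mulr1 mul1r.
have -> : ((3^-1)%:E * W = (2^-1)%:E * ((2 / 3)%:E * W))%E.
  by rewrite muleA -EFinM; congr (_%:E * _)%E; field.
apply: (@le_trans _ _ ((2^-1)%:E * (\sum_(i < n.+1) j)%:E)%E).
  by apply: lee_wpmul2l => //; rewrite lee_fin; lra.
have j0 : 0 <= j by rewrite Jj lee_fin in J0.
rewrite -EFinM lee_fin -(big_geq_mkord k n.+1 xpredT (fun=> j)) /= sumr_const_nat sumr_const card_ord.
rewrite -(mulr_natr j n.+1) -(mulr_natr j (n.+1 - k)) mulrCA ler_wpM2l //.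
have : (n.+1 <= 2 * (n.+1 - k))%N by lia.
rewrite -(ler_nat R) natrM => H.
by rewrite ler_pdivrMl ?ltr0n.
Qed.

End Radial.

(** * Adaptive deterministic algorithms *)

Section Functions.
Context {R : realType} {D : Type}.
Hypothesis inhD : inhabited D.
Implicit Types (f g : D -> R).

Lemma supnorm_le f M : (forall x, `|f x| <= M) -> supnorm f <= M.
Proof.
case: inhD => x0 fM; apply: ge_sup; first by exists `|f x0|, x0.
by move=> _ [x _ <-].
Qed.

Lemma le_supnorm f x : BD f -> `|f x| <= supnorm f.
Proof.
move=> [M fM]; apply: ub_le_sup; last by exists x.
by exists M => _ [y _ <-].
Qed.

Lemma supnorm_ge0 f : 0 <= supnorm f.
Proof.
have [[[y [x _ fx]] [M fM]]|H] := pselect (has_sup (range (fun x => `|f x|))).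
  apply: (le_trans (normr_ge0 (f x))); apply: ub_le_sup; last by exists x.
  by exists M.
(* For unbounded [f] the supremum takes its default value 0. *)
by rewrite /supnorm sup_out.
Qed.

Lemma BD0 : @BD R D (fun=> 0).
Proof. by exists 0 => x; rewrite normr0. Qed.

Lemma BDD f g : BD f -> BD g -> BD (fun x => f x + g x).
Proof.
move=> [M fM] [N gN]; exists (M + N) => x.
by apply: (le_trans (ler_normD _ _)); exact: lerD.
Qed.

Lemma BDZ k f : BD f -> BD (fun x => k * f x).
Proof. by move=> [M fM]; exists (`|k| * M) => x; rewrite normrM ler_wpM2l. Qed.

Lemma BDN f : BD f -> BD (fun x => - f x).
Proof. by move=> [M fM]; exists M => x; rewrite normrN. Qed.

Lemma BD_sum I (r : seq I) (P : pred I) (F : I -> D -> R) :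
  (forall i, BD (F i)) -> BD (fun x => \sum_(i <- r | P i) F i x).
Proof.
move=> bF; elim: r => [|i r IH].
  by under eq_fun do rewrite big_nil; exact: BD0.
under eq_fun do rewrite big_cons.
by case: (P i) => //; exact: BDD.
Qed.

Lemma supnormD f g : BD f -> BD g ->
  supnorm (fun x => f x + g x) <= supnorm f + supnorm g.
Proof.
move=> bf bg; apply: supnorm_le => x.
by apply: (le_trans (ler_normD _ _)); apply: lerD; exact: le_supnorm.
Qed.

Lemma supnormZ k f : BD f -> supnorm (fun x => k * f x) = `|k| * supnorm f.
Proof.
move=> bf; apply/eqP; rewrite eq_le; apply/andP; split.
  by apply: (supnorm_le (fun x => k * f x)) => x; rewrite normrM ler_wpM2l // le_supnorm.
have [->|k0] := eqVneq k 0; first by rewrite normr0 mul0r supnorm_ge0.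
rewrite -ler_pdivlMl ?normr_gt0 //; apply: (supnorm_le f) => x.
rewrite ler_pdivlMl ?normr_gt0 // -normrM.
exact: (@le_supnorm (fun x => k * f x) x (BDZ k f bf)).
Qed.

Lemma supnormN f : supnorm (fun x => - f x) = supnorm f.
Proof. by rewrite /supnorm; under eq_fun do rewrite normrN. Qed.

Definition lc n (u : 'I_n -> D -> R) (a : 'rV[R]_n) : D -> R :=
  fun x => \sum_(i < n) a 0 i * u i x.

Lemma BD_lc n (u : 'I_n -> D -> R) a : (forall i, BD (u i)) -> BD (lc n u a).
Proof. by move=> bu; apply: BD_sum => i; exact: BDZ. Qed.

Lemma lcN n (u : 'I_n -> D -> R) a x : lc n u (- a) x = - lc n u a x.
Proof. by rewrite /lc -sumrN; apply: eq_bigr => i _; rewrite mxE mulNr. Qed.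

Lemma lcZ n (u : 'I_n -> D -> R) k a x : lc n u (k *: a) x = k * lc n u a x.
Proof. by rewrite /lc mulr_sumr; apply: eq_bigr => i _; rewrite mxE mulrA. Qed.

Lemma lcB n (u : 'I_n -> D -> R) a b x : lc n u (a - b) x = lc n u a x - lc n u b x.
Proof. by rewrite /lc -sumrB; apply: eq_bigr => i _; rewrite !mxE mulrBl. Qed.

Lemma lc_mul n m (u : 'I_n -> D -> R) (Q : 'M[R]_(m, n)) a x :
  lc n u (a *m Q) x = lc m (fun i => lc n u (row i Q)) a x.
Proof.
rewrite /lc; under eq_bigr do rewrite mxE mulr_suml.
rewrite exchange_big; apply: eq_bigr => j _; rewrite mulr_sumr.
by apply: eq_bigr => i _; rewrite mxE mulrA.
Qed.

Lemma lc_cons_rv n (u : 'I_n.+1 -> D -> R) y a x :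
  lc n.+1 u (cons_rv n y a) x = y * u ord0 x + lc n (fun i => u (lift ord0 i)) a x.
Proof.
rewrite /lc big_ord_recl cons_rv_head; congr (_ + _).
by apply: eq_bigr => i _; rewrite cons_rv_lift.
Qed.

Lemma clin_lc n (L : (D -> R) -> R) g (u : 'I_n -> D -> R) a :
  clin_functional L -> BD g -> (forall i, BD (u i)) ->
  L (fun x => g x + lc n u a x) = L g + \sum_(i < n) a 0 i * L (u i).
Proof.
move=> [linL _] bg bu; rewrite /lc.
elim: (index_enum _) g bg => [|i r IH] g bg.
  rewrite big_nil addr0; congr L; apply/funext => x; by rewrite big_nil addr0.
rewrite big_cons addrA.
have <- : L (fun x => 1 * g x + a 0 i * u i x) = L g + a 0 i * L (u i).
  by rewrite linL // mul1r.
rewrite -IH; last by apply: BDD; exact: BDZ.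
by congr L; apply/funext => x; rewrite big_cons addrA mul1r.
Qed.

(** [info] appends measurements at the end, while the induction on algorithms removes the first
    one. *)
Lemma info_cons (L : nat -> seq R -> (D -> R) -> R) f k :
  info L f k.+1 = L 0 [::] f :: info (fun j ys => L j.+1 (L 0 [::] f :: ys)) f k.
Proof.
elim: k => [//|k IH].
by rewrite [LHS]/= -/(info L f k.+1) IH.
Qed.

Lemma det_alg_tail k (L : nat -> seq R -> (D -> R) -> R) (phi : seq R -> D -> R) y :
  det_alg k.+1 L phi ->
  det_alg k (fun j ys => L j.+1 (y :: ys)) (fun ys => phi (y :: ys)).
Proof.
move=> [hL hphi]; split => [j ys jk ys_j|ys]; last exact: hphi.
by apply: hL; rewrite //= ys_j.
Qed.

(* The first functional is rotated onto the first coordinate; fixing that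
   coordinate leaves an algorithm with one measurement less on the others.
   Without measurements, a and -a receive the same output. *)
Lemma det_alg_lower n k (w : R -> R) (sg : R) (u : 'I_n -> D -> R) g L phi :
  (k <= n)%N -> 0 <= sg -> (forall s, 0 <= w s) -> (forall s, 1 < s -> w s = 0) ->
  measurable_fun setT w ->
  (forall i, BD (u i)) -> BD g -> det_alg k L phi ->
  (forall a, sg ^+ 2 * sqn n a <= supnorm (lc n u a) ^+ 2) ->
  let f a := fun x => g x + lc n u a x in
  let err a := w (sqn n a) * supnorm (fun x => f a x - alg_out k L phi (f a) x) in
  meas_ge0 n (fun a => (err a)%:E) ->
  (itint n (fun a => (sg * (w (sqn n a) * \sum_(i < n | (k <= i)%N) a 0%R i ^+ 2))%:E) <=
   itint n (fun a => (err a)%:E))%E.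
Proof.
elim: k n w u g L phi => [|k IH] n w u g L phi kn sg0 w0 w1 mw bu bg alg low f err merr.
  have mlow : meas_ge0 n (fun a =>
      (sg * (w (sqn n a) * \sum_(i < n | (0 <= i)%N) a 0%R i ^+ 2))%:E).
    apply: meas_ge0_EFin => [|a].
      apply: measurable_funM => //.
      by apply: measurable_funM; [exact: measurable_radial | exact: measurable_sqsum].
    by rewrite !mulr_ge0 // sumr_ge0 // => i _; exact: sqr_ge0.
  (* Both sides are doubled, and on the right the second copy is reflected, which pairs the error at
     [a] with the error at [- a]. *)
  rewrite -(@lee_pmul2l R 2%:E) ?lte_fin // -!itintZ //.
  have -> : itint n (fun a => 2%:E * (err a)%:E)%E =
      itint n (fun a => (err a)%:E + (err (- a))%:E)%E.
    rewrite itintZ // (itintD n (fun a => (err a)%:E) (fun a => (err (- a))%:E)) //.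
      2: exact: (meas_ge0N n _ merr).
    by rewrite (itintN n _ merr) mule_natl mule2n.
  apply: le_itint.
  - exact: meas_ge0Z.
  - exact: (meas_ge0D n _ _ merr (meas_ge0N n _ merr)).
  - move=> a; rewrite -EFinM -EFinD lee_fin /err sqnN -mulrDr.
    rewrite [leLHS](_ : _ = w (sqn n a) * (2 * (sg * sqn n a))); last first.
      by rewrite /sqn; ring.
    have [s1|s1] := ltrP 1 (sqn n a); first by rewrite w1 // !mul0r.
    apply: ler_wpM2l => //.
    set l := lc n u a; have bl : BD l by exact: BD_lc.
    (* Here [sqn n a <= 1], so its square is no larger than itself; the bound between squares in
       [low] thus yields one that is linear in [sqn n a]. *)
    have sl : sg * sqn n a <= supnorm l.
      rewrite -(@ler_pXn2r _ 2) ?nnegrE ?supnorm_ge0 ?mulr_ge0 ?sqn_ge0 //.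
      apply: le_trans (low a); rewrite exprMn ler_wpM2l ?sqr_ge0 //.
      by rewrite expr2 ler_piMr ?sqn_ge0.
    apply: (@le_trans _ _ (2 * supnorm l)); first by rewrite ler_wpM2l.
    have [hphi0 hphi] := alg.
    rewrite -[X in X * _]ger0_norm // -supnormZ //.
    rewrite [X in supnorm X](_ : _ = fun x => (f a x - alg_out 0 L phi (f a) x)
       + - (f (- a) x - alg_out 0 L phi (f (- a)) x)); last first.
      by apply/funext => x; rewrite /f lcN -/l /alg_out /=; ring.
    rewrite -[X in _ + X]supnormN; apply: supnormD.
      by apply: BDD; [apply: BDD => //; exact: BD_lc | exact/BDN/hphi].
    by apply/BDN/BDD; [apply: BDD => //; exact: BD_lc | exact/BDN/hphi].
case: n kn u @f @err low bu merr => // n kn u f err low bu merr.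
have [hL hphi] := alg.
have clin0 : clin_functional (L 0%N [::]) by exact: hL.
have [Q [kap [[QQ iQ] Qk]]] := orth_inv_exists n (\row_i L 0%N [::] (u i)).
pose v i := lc n.+1 u (row i Q).
have bv i : BD (v i) by exact: BD_lc.
have lcQ a : lc n.+1 u (a *m Q) = lc n.+1 v a.
  by apply/funext => x; exact: lc_mul.
(* In the rotated family the first measurement sees only [v ord0]. *)
have Lv i : L 0%N [::] (v (lift ord0 i)) = 0.
  have := clin_lc n.+1 (L 0%N [::]) (fun=> 0) u (row (lift ord0 i) Q) clin0 BD0 bu.
  under [X in L _ _ X]eq_fun do rewrite add0r.
  rewrite -/(lc _ _ _) -/(v _) => ->.
  have -> : L 0%N [::] (fun=> 0) = 0.
    have [lin _] := clin0; have := lin 0 0 _ _ BD0 BD0.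
    by rewrite /= !mul0r !addr0.
  rewrite add0r; transitivity ((\row_i L 0%N [::] (u i) *m Q^T) 0 (lift ord0 i)).
    by rewrite mxE; apply: eq_bigr => j _; rewrite !mxE mulrC.
  by rewrite Qk !mxE mulr0.
rewrite -(iQ _ merr) /=.
have merrQ := meas_ge0_lin _ _ Q _ merr.
apply: ge0_le_integral => //.
- move=> x _; apply: itint_ge0 => a.
  by rewrite lee_fin !mulr_ge0 // sumr_ge0 // => i _; exact: sqr_ge0.
- apply: (@meas_ge0_itint _ _ (fun a => (sg * (w (sqn n.+1 a) *
      \sum_(i < n.+1 | (k < i)%N) a 0%R i ^+ 2))%:E)).
  apply: meas_ge0_EFin => [|a].
    apply: measurable_funM => //.
    by apply: measurable_funM; [exact: measurable_radial | exact: measurable_sqsum].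
  by rewrite !mulr_ge0 // sumr_ge0 // => i _; exact: sqr_ge0.
- exact: meas_ge0_itint _ _ merrQ.
- move=> y _.
  (* For a fixed first coordinate [y], the term [y * v ord0] joins the offset and [y ^+ 2] joins the
     argument of the weight. The first measurement then has the constant value [y1], and the
     induction hypothesis applies to the remaining coordinates. *)
  pose g' x := g x + y * v ord0 x.
  have bg' : BD g' by apply: BDD => //; exact: BDZ.
  pose v' i := v (lift ord0 i).
  have bv' i : BD (v' i) by exact: bv.
  pose y1 := L 0%N [::] g'.
  pose w' s := w (y ^+ 2 + s).
  have fE b : f (cons_rv n y b *m Q) = fun x => g' x + lc n v' b x.
    by apply/funext => x; rewrite /f lcQ lc_cons_rv addrA.
  have outE b : alg_out k.+1 L phi (f (cons_rv n y b *m Q)) =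
      alg_out k (fun j ys => L j.+1 (y1 :: ys)) (fun ys => phi (y1 :: ys))
        (fun x => g' x + lc n v' b x).
    rewrite fE /alg_out info_cons.
    rewrite (_ : L 0%N [::] _ = y1) // (clin_lc n _ g' v' b clin0 bg' bv').
    by rewrite big1 ?addr0 // => i _; rewrite Lv mulr0.
  have errE b : err (cons_rv n y b *m Q) = w' (sqn n b) *
      supnorm (fun x => (g' x + lc n v' b x) -
       alg_out k (fun j ys => L j.+1 (y1 :: ys)) (fun ys => phi (y1 :: ys))
        (fun x => g' x + lc n v' b x) x).
    by rewrite /err outE sqn_orth // sqn_cons_rv fE.
  have := IH n w' v' g' _ _ kn sg0 (fun s => w0 _) _ _ bv' bg' (det_alg_tail k _ _ y1 alg).
  rewrite (@eq_itint _ n (fun a => (sg * (w (sqn n.+1 (cons_rv n y a)) * _))%:E)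
    (fun a => (sg * (w' (sqn n a) * \sum_(i < n | (k <= i)%N) a 0%R i ^+ 2))%:E)); last first.
    move=> b; rewrite sqn_cons_rv; congr ((_ * (_ * _))%:E).
    rewrite big_mkcond big_ord_recl /= add0r [RHS]big_mkcond.
    by apply: eq_bigr => i _; rewrite cons_rv_lift.
  rewrite [in X in _ -> (_ <= X)%E](@eq_itint _ n _ _ (fun b => congr1 EFin (errE b))).
  apply.
  + by move=> s s1; apply: w1; have := sqr_ge0 y; lra.
  + by apply: measurableT_comp => //; apply: measurable_funD.
  + move=> b; have -> : lc n v' b = lc n.+1 u (cons_rv n 0 b *m Q).
      by apply/funext => x; rewrite lcQ lc_cons_rv mul0r add0r.
    have -> : sqn n b = sqn n.+1 (cons_rv n 0 b *m Q).
      by rewrite sqn_orth // sqn_cons_rv expr0n add0r.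
    exact: low.
  + have := meas_ge0_section n _ y merrQ.
    by under eq_fun do rewrite errE.
Qed.

End Functions.

(** * Randomized algorithms *)

(** The sets whose preimage in [B] is measurable form a sigma-algebra on [D0], so it is enough to
    test generators. *)
Lemma measurable_preimage_sigma (X : Type) (D0 : set X) (G : set (set X))
    d (T : measurableType d) (B : set T) (h : T -> X) :
  measurable B -> (forall t, B t -> D0 (h t)) ->
  (forall A, G A -> measurable (B `&` h @^-1` A)) ->
  forall A, <<s D0, G >> A -> measurable (B `&` h @^-1` A).
Proof.
move=> mB BD0 hG; apply: smallest_sub => //; split.
- by rewrite preimage_set0 setI0.
- move=> A mA.
  rewrite (_ : _ `&` _ = B `\` (B `&` h @^-1` A)); first exact: measurableD.
  apply/seteqP; split => t /=; first by move=> [Bt [_ nA]]; split => // -[].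
  by move=> [Bt nBA]; split => //; split; [exact: BD0 | move=> At; exact: nBA].
- move=> A mA; rewrite preimage_bigcup setI_bigcupr.
  exact: bigcupT_measurable.
Qed.

Section RandomizedLowerBound.
Context {R : realType} {D : Type}.
Hypothesis inhD : inhabited D.
Variables (F : set (D -> R)) (n : nat) (u : 'I_n.+1 -> D -> R).
Hypothesis FBD : F `<=` @BD R D.
Hypothesis uF : forall a, sqn n.+1 a <= 1 -> F (lc n.+1 u a).

Let bu i : BD (u i).
Proof.
have -> : u i = lc n.+1 u (delta_mx 0 i).
  apply/funext => x; rewrite /lc (bigD1 i) //= big1 => [|j ji].
    by rewrite mxE !eqxx mul1r addr0.
  by rewrite mxE eqxx (negbTE ji) mul0r.
by apply/FBD/uF; rewrite sqn_delta.
Qed.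

Let unit_ball : set (n.+1.-tuple R) := [set t | sqn n.+1 (rv_of n.+1 t) <= 1].

Let measurable_unit_ball : measurable unit_ball.
Proof.
have := @measurable_sqsum R n.+1 xpredT measurableT `]-oo, 1]%classic (measurable_itv _).
by rewrite setTI; congr measurable.
Qed.

(** Open cubes with rational centre and radius, a countable base of the topology. *)
Let box (q : n.+1.-tuple rat) (r : rat) : set (n.+1.-tuple R) :=
  \bigcap_(i in setT) [set t | `|tnth t i - ratr (tnth q i)| < ratr r].

Let measurable_box q r : measurable (box q r).
Proof.
apply: fin_bigcap_measurable; first exact: finite_finset.
move=> i _.
rewrite (_ : [set t | _] = (@tnth _ R ^~ i) @^-1`
   `]ratr (tnth q i) - ratr r, ratr (tnth q i) + ratr r[%classic).
  by rewrite -[X in measurable X]setTI; exact: measurable_tnth.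
by apply/seteqP; split => t /=; rewrite in_itv /= ltr_distl.
Qed.

(** Divided by [e / 2], the difference is the image of a vector of the unit ball minus the image of
    0, hence an element of [F - F]. So [lc] is continuous on row vectors for the seminorm [pF F]. *)
Lemma pF_lc_lt (a b : 'rV[R]_n.+1) e : 0 < e ->
  sqn n.+1 (a - b) <= (e / 2) ^+ 2 ->
  pF F (fun x => lc n.+1 u a x - lc n.+1 u b x) < e.
Proof.
move=> e0 abe; apply: (@le_lt_trans _ _ (e / 2)); last by lra.
apply: ge_inf; first by exists 0 => t /= [/ltW].
have e2 : 0 < e / 2 by lra.
split => //; exists (lc n.+1 u ((e / 2)^-1 *: (a - b))), (lc n.+1 u 0); split.
  apply: uF; rewrite sqnZ exprVn ler_pdivrMl ?mulr1 //.
  by rewrite exprn_gt0.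
split; first by apply: uF; rewrite /sqn big1 // => i _; rewrite mxE expr0n.
apply/funext => x; rewrite lcZ lcB [X in _ = _ - X]big1 ?subr0 //.
by move=> i _; rewrite mxE mul0r.
Qed.

(** The preimage is relatively open in the unit ball, hence the trace of a countable union of
    rational cubes, namely those whose trace on the ball lies in it. *)
Let measurable_open U : openF F U ->
  measurable (unit_ball `&` (fun t => lc n.+1 u (rv_of n.+1 t)) @^-1` U).
Proof.
move=> [_ oU]; set V := _ `&` _.
pose good (p : n.+1.-tuple rat * rat) := `[< unit_ball `&` box p.1 p.2 `<=` V >].
pose G k := if unpickle k is Some p then
  if good p then box p.1 p.2 else set0 else set0.
suff -> : V = unit_ball `&` \bigcup_k G k.
  apply: measurableI => //; apply: bigcupT_measurable => k.
  by rewrite /G; case: unpickle => // p; case: ifP.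
apply/seteqP; split=> [t Vt|t [Bt [k _]]]; last first.
  rewrite /G; case: unpickle => // p; case: ifP => // /asboolP gp bt.
  exact: gp.
have [Bt Ut] := Vt; split => //.
have [e e0 eU] := oU _ Ut.
(* Points of one cube of radius below [r0] differ by less than [2 * r0] in each coordinate, so their
   squared distance is at most [(e / 2) ^+ 2]. *)
pose r0 : R := e / (4 * n.+1%:R).
have r00 : 0 < r0 by rewrite divr_gt0 // mulr_gt0.
have [r] := rat_in_itvoo r00; rewrite in_itv /= => /andP[r_gt0 r_lt].
have hq i : {q : rat | `|tnth t i - ratr q| < ratr r}.
  apply: cid; have /rat_in_itvoo[q] : tnth t i - ratr r < tnth t i + ratr r by lra.
  by rewrite in_itv /= => H; exists q; rewrite ltr_distlC.
pose q := [tuple sval (hq i) | i < n.+1].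
have tq : box q r t by move=> i _ /=; rewrite tnth_mktuple; exact: (svalP (hq i)).
have gq : good (q, r).
  apply/asboolP => s /= [Bs sq]; split => //; apply: eU; first exact: uF.
  apply: pF_lc_lt => //.
  apply: (@le_trans _ _ (\sum_(i < n.+1) (2 * r0) ^+ 2)).
    apply: ler_sum => i _; rewrite !mxE -real_normK ?num_real //.
    rewrite ler_pXn2r ?nnegrE ?mulr_ge0 ?(ltW r00) ?(ltW e0) //.
    have := sq i I; have := tq i I => /= H1 H2.
    rewrite (_ : _ - _ = (tnth s i - ratr (tnth q i)) - (tnth t i - ratr (tnth q i))); last by ring.
    by apply: (le_trans (ler_normB _ _)); lra.
  rewrite sumr_const card_ord -[_ *+ n.+1]mulr_natl.
  have -> : 2 * r0 = (e / 2) / n.+1%:R.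
    have H (m : R) : m != 0 -> 2 * (e / (4 * m)) = e / 2 / m by move=> m0; field.
    by rewrite /r0 H // pnatr_eq0.
  rewrite exprMn mulrCA ler_piMr ?sqr_ge0 //.
  rewrite exprVn expr2 invfM mulrA divff ?pnatr_eq0 // mul1r.
  by rewrite invf_le1 ?ler1n.
exists (pickle (q, r)) => //; rewrite /G pickleK gq.
exact: tq.
Qed.

Section Algorithm.
Variables (d : measure_display) (Om : measurableType d).
Variables (L : Om -> nat -> seq R -> (D -> R) -> R) (phi : Om -> seq R -> D -> R).
Variable k : nat.
Hypothesis alg : rand_alg F k L phi.

Let err (a : 'rV[R]_n.+1) (w : Om) : R :=
  supnorm (fun x => lc n.+1 u a x - alg_out k (L w) (phi w) (lc n.+1 u a) x).

(** The measurability built into [rand_alg] lives on [F] times [Om] and is pulled back along [lc].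
    Rectangles go to rectangles, and their first sides are handled by the Borel case. *)
Lemma measurable_alg_err : measurable_fun (unit_ball `*` [set: Om])
  (fun p : n.+1.-tuple R * Om => err (rv_of n.+1 p.1) p.2).
Proof.
move=> mB S mS.
have [_ /(_ S mS) H] := alg.
pose h (p : n.+1.-tuple R * Om) := (lc n.+1 u (rv_of n.+1 p.1), p.2).
have BF (p : n.+1.-tuple R * Om) : (unit_ball `*` [set: Om]) p ->
    (F `*` [set: Om]) (h p).
  by move=> [Bp _]; split => //; exact: uF.
have := @measurable_preimage_sigma _ (F `*` [set: Om]) _ _ _ _ h mB BF _ _ H.
set A := _ `&` _ => mA; set A' := _ `&` _.
suff -> : A' = A.
  apply: mA => _ [A1 [A2 [bA1 [mA2 ->]]]].
  rewrite (_ : _ `&` _ = (unit_ball `&` (fun t => lc n.+1 u (rv_of n.+1 t)) @^-1` A1) `*` A2).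
    apply: measurableX => //.
    apply: (measurable_preimage_sigma _ F (openF F)) => // t; exact: uF.
  by apply/seteqP; split=> [p [[? _] [? ?]]|p [[? ?] ?]].
apply/seteqP; split=> [p [Bp Sp]|p [Bp [_ Sp]]]; split => //.
by split => //; exact: BF.
Qed.

Let h (a : 'rV[R]_n.+1) (w : Om) : R := shell (2 / 3) 1 (sqn n.+1 a) * err a w.

Let h_ge0 a w : 0 <= h a w.
Proof. by rewrite mulr_ge0 ?shell_ge0 ?supnorm_ge0. Qed.

Let measurable_h :
  measurable_fun setT (fun p : n.+1.-tuple R * Om => h (rv_of n.+1 p.1) p.2).
Proof.
have mBT : measurable (unit_ball `*` [set: Om]) by exact: measurableX.
(* The shell factor vanishes off the unit ball, so the error may be replaced there by 0. *)
rewrite (_ : (fun _ => _) = fun p => shell (2 / 3) 1 (sqn n.+1 (rv_of n.+1 p.1)) *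
   ((fun p : n.+1.-tuple R * Om => err (rv_of n.+1 p.1) p.2) \_
     (unit_ball `*` [set: Om])) p).
  apply: measurable_funM; last first.
    by apply/(measurable_restrictT _ mBT); exact: measurable_alg_err.
  apply: (measurableT_comp (f := fun t : n.+1.-tuple R =>
     shell (2 / 3) 1 (sqn n.+1 (rv_of n.+1 t)))) => //.
  exact: measurable_radial (measurable_shell _ _).
apply/funext => p; rewrite /h patchE; case: ifPn => // /negP nB.
rewrite shellE; case: (boolP (2 / 3 <= _ <= 1)) => [/andP[_ H]|_]; last by rewrite !mul0r.
by exfalso; apply: nB; rewrite inE.
Qed.

(** The worst case dominates an average. For each [w] the error integrated over the shell is at
    least [sg / 3] times the mass [W] of the shell; by Tonelli the integral over [w] may be taken
    first, and it is at most the randomized error at every point of the shell. *)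
Lemma rand_err_lower (P : probability Om R) (sg : R) : (2 * k <= n.+1)%N -> 0 <= sg ->
  (forall a, sg ^+ 2 * sqn n.+1 a <= supnorm (lc n.+1 u a) ^+ 2) ->
  ((sg / 3)%:E <= rand_err F k P L phi)%E.
Proof.
move=> kn sg0 low; set E := rand_err _ _ _ _ _.
have E0 : (0 <= E)%E by apply: ereal_sup_ubound; left.
have [->|Efin] := eqVneq E +oo%E; first by rewrite leey.
have Efin' : E \is a fin_num by rewrite ge0_fin_numE // ltey.
pose W : \bar R := itint n.+1 (fun a => (shell (2 / 3) 1 (sqn n.+1 a))%:E).
have W0 : (0 < W)%E by apply: itint_shell_gt0; lra.
have Wfin : W \is a fin_num.
  rewrite ge0_fin_numE ?ltW //; apply: le_lt_trans (itint_shell_lt_pinfty n.+1).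
  apply: le_itint; [exact: meas_ge0_shell | exact: meas_ge0_shell |].
  move=> a; rewrite lee_fin !shellE; case: (boolP (2 / 3 <= _ <= 1)) => // /andP[H1 H2].
  by have -> : 0 <= sqn n.+1 a <= 1 by lra.
rewrite -(@lee_pmul2r _ W) //.
have mh1 w : meas_ge0 n.+1 (fun a => (h a w)%:E).
  apply: meas_ge0_EFin => [|a]; last exact: h_ge0.
  exact: (measurable_fun_pair1 w measurable_h).
have mh2 : measurable_fun setT
    (fun p : Om * n.+1.-tuple R => (h (rv_of n.+1 p.2) p.1)%:E).
  apply/measurable_EFinP; apply: (measurableT_comp measurable_h
    (g := fun p : Om * n.+1.-tuple R => (p.2, p.1))).
  exact: measurable_fun_pair.
apply: (@le_trans _ _ (\int[P]_w itint n.+1 (fun a => (h a w)%:E))%E).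
  rewrite -[leLHS]mule1 -(@probability_setT _ _ _ P) -integral_cst //.
  apply: ge0_le_integral => //.
  - by move=> w _; rewrite mule_ge0 ?lee_fin ?divr_ge0 // ltW.
  - apply: (@measurable_itint _ _ _ _ (fun w a => (h a w)%:E)) => // w a.
    by rewrite lee_fin h_ge0.
  - move=> w _; have [halg _] := alg.
    have fE a : (fun x => 0 + lc n.+1 u a x) = lc n.+1 u a.
      by apply/funext => x; rewrite add0r.
    have hE : (fun a => (shell (2 / 3) 1 (sqn n.+1 a) * supnorm (fun x => 0 + lc n.+1 u a x -
        alg_out k (L w) (phi w) (fun x => 0 + lc n.+1 u a x) x))%:E) =
        (fun a => (h a w)%:E).
      apply/funext => a; rewrite fE /h /err; congr (_ * supnorm _)%:E.
      by apply/funext => x; rewrite add0r.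
    have kn' : (k <= n.+1)%N by lia.
    have w1 (s : R) : 1 < s -> shell (2 / 3) 1 s = 0.
      by move=> s1; rewrite shellE; case: (boolP (2 / 3 <= _ <= 1)) => // /andP[_]; rewrite leNgt s1.
    apply: (@le_trans _ _ (itint n.+1 (fun a => (sg * (shell (2 / 3) 1 (sqn n.+1 a) *
        \sum_(i < n.+1 | (k <= i)%N) a 0%R i ^+ 2))%:E))); last first.
      have mE := mh1 w; rewrite -hE in mE *.
      exact: (det_alg_lower inhD n.+1 k (shell (2 / 3) 1) sg u (fun=> 0) (L w) (phi w)
        kn' sg0 (shell_ge0 (2 / 3) 1) w1 (measurable_shell _ _) bu BD0 (halg w) low mE).
    under eq_itint do rewrite EFinM.
    rewrite itintZ //; last first.
      apply: meas_ge0_EFin => [|a].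
        apply: measurable_funM; last exact: measurable_sqsum.
        exact: measurable_radial (measurable_shell _ _).
      by rewrite mulr_ge0 ?shell_ge0 // sumr_ge0 // => i _; exact: sqr_ge0.
    rewrite /cst /= EFinM -muleA; apply: lee_wpmul2l; first by rewrite lee_fin.
    exact: itint_shell_tail.
rewrite (@itint_tonelli _ n.+1 _ _ P (fun w a => (h a w)%:E) mh2); last first.
  by move=> w a; rewrite lee_fin h_ge0.
rewrite -(fineK Efin') -itintZ; [|exact: fine_ge0|exact: meas_ge0_shell].
apply: le_itint.
- split; last by move=> a; apply: integral_ge0 => w _; rewrite lee_fin h_ge0.
  apply: (@measurable_fun_fubini_tonelli_F _ _ _ _ R P
    (fun p : n.+1.-tuple R * Om => (h (rv_of n.+1 p.1) p.2)%:E)).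
    exact/measurable_EFinP.
  by move=> p; rewrite lee_fin h_ge0.
- by apply: meas_ge0Z; [exact: fine_ge0 | exact: meas_ge0_shell].
- move=> a; rewrite fineK // /h shellE.
  case: (boolP (2 / 3 <= _ <= 1)) => [/andP[_ a1]|_]; last first.
    rewrite mule0 (eq_integral (cst 0%E)) ?integral_cst ?mul0e //.
    by move=> w _; rewrite mul0r.
  rewrite mule1; under eq_integral do rewrite mul1r.
  apply: ereal_sup_ubound; right; exists (lc n.+1 u a) => //; exact: uF.
Qed.

End Algorithm.

Lemma e_ran_lower k (sg : R) : (2 * k <= n.+1)%N -> 0 <= sg ->
  (forall a, sg ^+ 2 * sqn n.+1 a <= supnorm (lc n.+1 u a) ^+ 2) ->
  ((sg / 3)%:E <= e_ran F k)%E.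
Proof.
move=> kn sg0 low; apply/ereal_infP => _ [d [Om [P [L [phi [alg ->]]]]]].
exact: rand_err_lower.
Qed.

End RandomizedLowerBound.

(** * Determinants and randomized errors *)

Section Elimination.
Context {R : realType} {D : Type}.
Hypothesis inhD : inhabited D.
Variable F : set (D -> R).
Hypothesis FBD : F `<=` @BD R D.

Lemma e_ran_ge0 k : (0 <= e_ran F k)%E.
Proof.
apply/ereal_infP => _ [d [Om [P [L [phi [_ ->]]]]]].
by apply: ereal_sup_ubound; left.
Qed.

Lemma orth_det (n : nat) (Q : 'M[R]_n) : Q *m Q^T = 1%:M -> `|\det Q| = 1.
Proof.
move=> /(congr1 determinant); rewrite det_mulmx det_tr det1 -expr2 => Q2.
by apply/eqP; rewrite -sqrp_eq1 // real_normK ?num_real // Q2.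
Qed.

(** Induction on the dimension. A unit vector that [G] maps to length at most [B] is rotated onto
    the first axis, and so is its image; [G] then becomes block lower triangular with a corner of
    size at most [B], and the complementary block satisfies the same hypotheses. Dimension [l + 1]
    admits [l./2] measurements. *)
Lemma det_le_prod_e_ran K (N : R) (E : nat -> R) : 0 < N ->
  (forall k, (k < K)%N -> (e_ran F k < (E k)%:E)%E) ->
  forall i (u : 'I_i -> D -> R) (G : 'M[R]_i), (i <= K.*2)%N ->
  (forall a, sqn i a <= 1 -> F (lc i u a)) ->
  (forall a, sqn i (a *m G) <= N ^+ 2 * supnorm (lc i u a) ^+ 2) ->
  `|\det G| <= \prod_(l < i) (3 * N * E l./2).
Proof.
move=> N0 eE; elim=> [|i IH] u G iK uF uG.
  by rewrite det_mx00 big_ord0 normr1.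
have kK : (i./2 < K)%N by lia.
have E0 : 0 < E i./2 by rewrite -lte_fin; apply: le_lt_trans (eE _ kK); exact: e_ran_ge0.
set B := 3 * N * E i./2.
have B0 : 0 < B by rewrite !mulr_gt0.
(* Otherwise [G] stretches every vector by at least [B], so by [uG] the sup-norm dominates
   [B / N = 3 * E i./2] times the Euclidean norm. By [e_ran_lower] the randomized error would be at
   least [E i./2]. *)
have [c c1 cG] : exists2 c, sqn i.+1 c = 1 & sqn i.+1 (c *m G) <= B ^+ 2.
  apply: contrapT => H; have := eE _ kK; apply/negP; rewrite -leNgt.
  rewrite (_ : E i./2 = 3 * E i./2 / 3); last by field.
  apply: (e_ran_lower inhD F i u FBD uF) => [||a]; first by lia.
    by rewrite mulr_ge0 // ltW.
  have [a0|a0] := eqVneq (sqn i.+1 a) 0; first by rewrite a0 mulr0 sqr_ge0.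
  have sa0 : 0 < sqn i.+1 a by rewrite lt_def a0 sqn_ge0.
  pose s := Num.sqrt (sqn i.+1 a).
  have s2 : s ^+ 2 = sqn i.+1 a by rewrite sqr_sqrtr // ltW.
  have s0 : s != 0 by rewrite sqrtr_eq0 -ltNge.
  have c1 : sqn i.+1 (s^-1 *: a) = 1 by rewrite sqnZ exprVn s2 mulVf.
  have cB : B ^+ 2 < sqn i.+1 (s^-1 *: a *m G).
    by rewrite ltNge; apply/negP => cB; apply: H; exists (s^-1 *: a).
  rewrite -(ler_pM2l (exprn_gt0 2 N0)); apply: le_trans (uG a).
  rewrite [leLHS](_ : _ = s ^+ 2 * B ^+ 2); last by rewrite s2 /B; ring.
  rewrite -(scale1r a) -(divff s0) -scalerA -scalemxAl sqnZ.
  by rewrite ler_pM2l ?ltW // exprn_even_gt0.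
have [Q [kap [[QQ _] Qk]]] := orth_inv_exists i c.
have QQ' : Q^T *m Q = 1%:M by exact: mulmx1C.
have kap1 : kap ^+ 2 = 1.
  have := sqn_orth i.+1 c Q^T; rewrite trmxK QQ' Qk sqnZ sqn_delta mulr1 c1; exact.
pose e0 : 'rV[R]_i.+1 := delta_mx 0 0.
have e0Q : e0 *m Q = kap *: c.
  by rewrite -[c]mulmx1 -QQ' mulmxA Qk -scalemxAl scalerA -expr2 kap1 scale1r.
have [P [rho [[PP _] Pr]]] := orth_inv_exists i (e0 *m Q *m G).
have PP' : P^T *m P = 1%:M by exact: mulmx1C.
have rhoB : `|rho| <= B.
  rewrite -(@ler_pXn2r _ 2) ?nnegrE ?(ltW B0) // real_normK ?num_real //.
  have := sqn_orth i.+1 (e0 *m Q *m G) P^T; rewrite trmxK PP' Pr sqnZ sqn_delta mulr1 => -> //.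
  by rewrite e0Q -scalemxAl sqnZ kap1 mul1r.
pose G2 : 'M[R]_(1 + i) := Q *m G *m P^T.
have G2row j : G2 0 j = rho * (j == 0)%:R.
  transitivity ((e0 *m G2) 0 j); first by rewrite -rowE [RHS]mxE.
  by rewrite /G2 !mulmxA Pr !mxE eqxx.
have detG2 : `|\det G2| = `|\det G|.
  by rewrite !det_mulmx !normrM (orth_det _ Q) // (orth_det _ P^T) ?trmxK // mul1r mulr1.
have sqnG2 (b : 'rV[R]_i.+1) : sqn i.+1 (b *m G2) = sqn i.+1 (b *m Q *m G).
  by rewrite -[RHS](sqn_orth i.+1 _ P^T) ?trmxK // /G2 !mulmxA.
clearbody G2.
have ulG2 : ulsubmx G2 = rho%:M.
  apply/matrixP => x y; rewrite !ord1 !mxE eqxx mulr1n.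
  by rewrite (_ : lshift i 0 = 0) ?G2row ?eqxx ?mulr1 //; apply/val_inj.
have urG2 : ursubmx G2 = 0.
  apply/matrixP => x y; rewrite !ord1 !mxE.
  by rewrite (_ : lshift i 0 = 0) ?G2row ?mulr0 //; apply/val_inj.
have detG : `|\det G| = `|rho| * `|\det (drsubmx G2)|.
  by rewrite -detG2 -[in LHS](submxK G2) urG2 det_lblock ulG2 det_scalar expr1 normrM.
rewrite detG big_ord_recr /= mulrC; apply: ler_pM => //.
have lcE b : lc i (fun j => lc i.+1 u (row (lift ord0 j) Q)) b =
    lc i.+1 u (cons_rv i 0 b *m Q).
  by apply/funext => x; rewrite lc_mul lc_cons_rv mul0r add0r.
apply: (IH (fun j => lc i.+1 u (row (lift ord0 j) Q))) => [|b b1|b].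
- by lia.
- by rewrite lcE; apply: uF; rewrite sqn_orth // sqn_cons_rv expr0n add0r.
- rewrite lcE; apply: le_trans (uG _).
  rewrite -sqnG2.
  (* A vector with first coordinate 0 does not meet the first row of [G2]; discarding the first
     column can only shorten the image. *)
  have -> : cons_rv i 0 b *m G2 = row_mx (b *m dlsubmx G2) (b *m drsubmx G2).
    rewrite -[in LHS](submxK G2) /cons_rv raddf0.
    apply: (etrans (mul_row_block (0 : 'M[R]_1) b _ _ _ _)).
    by rewrite !mul0mx !add0r.
  rewrite [leRHS]/sqn -[i.+1]/(1 + i)%N big_split_ord /= -[leLHS]add0r.
  apply: lerD; first by apply: sumr_ge0 => j _; exact: sqr_ge0.
  by rewrite /sqn; apply: ler_sum => j _; rewrite row_mxEr.
Qed.

(** * Positivity of the errors and extraction of the root *)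

Lemma cauchy_schwarz_sum n (a b : 'I_n -> R) :
  (\sum_i a i * b i) ^+ 2 <= (\sum_i a i ^+ 2) * (\sum_i b i ^+ 2).
Proof.
elim: n a b => [|n IH] a b; first by rewrite !big_ord0 expr0n mul0r.
rewrite !big_ord_recl; have := IH (fun i => a (lift ord0 i)) (fun i => b (lift ord0 i)).
set S := \sum_i _; set A := \sum_i _; set C := \sum_i _ => H.
have A0 : 0 <= A by apply: sumr_ge0 => i _; exact: sqr_ge0.
have C0 : 0 <= C by apply: sumr_ge0 => i _; exact: sqr_ge0.
move: (a ord0) (b ord0) => x y.
suff K : 2 * (x * y * S) <= x ^+ 2 * C + A * y ^+ 2.
  rewrite -subr_ge0 (_ : _ - _ = (A * C - S ^+ 2) +
    (x ^+ 2 * C + A * y ^+ 2 - 2 * (x * y * S))); last by ring.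
  by rewrite addr_ge0 // subr_ge0.
have X0 : 0 <= x ^+ 2 * C + A * y ^+ 2 by rewrite addr_ge0 // mulr_ge0 ?sqr_ge0.
apply: (le_trans (ler_norm _)); rewrite -(@ler_pXn2r _ 2) ?nnegrE // real_normK ?num_real //.
have H2 : (x * y * S) ^+ 2 <= (x ^+ 2 * C) * (A * y ^+ 2).
  rewrite [leLHS](_ : _ = (x * y) ^+ 2 * S ^+ 2); last by ring.
  rewrite [leRHS](_ : _ = (x * y) ^+ 2 * (A * C)); last by ring.
  by apply: ler_wpM2l => //; exact: sqr_ge0.
have := sqr_ge0 (x ^+ 2 * C - A * y ^+ 2); move: H2.
move: (x * y * S) (x ^+ 2 * C) (A * y ^+ 2) => p q r; nra.
Qed.

(** The Frobenius norm bounds the operator norm, by Cauchy-Schwarz in each column. *)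
Lemma sqn_mul n (b : 'rV[R]_n) (A : 'M[R]_n) :
  sqn n (b *m A) <= sqn n b * \sum_j \sum_i A i j ^+ 2.
Proof.
rewrite /sqn [leRHS]mulr_sumr; apply: ler_sum => j _; rewrite mxE.
exact: cauchy_schwarz_sum.
Qed.

(** The Frobenius norm of the inverse of [G] bounds the Euclidean norm of [a] by a multiple of the
    sup-norm, so [e_ran_lower] applies with some positive constant. *)
Lemma e_ran_gt0 n k (N : R) (u : 'I_n.+1 -> D -> R) (G : 'M[R]_n.+1) :
  (2 * k <= n.+1)%N -> 0 < N -> G \in unitmx ->
  (forall a, sqn n.+1 a <= 1 -> F (lc n.+1 u a)) ->
  (forall a, sqn n.+1 (a *m G) <= N ^+ 2 * supnorm (lc n.+1 u a) ^+ 2) ->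
  (0 < e_ran F k)%E.
Proof.
move=> kn N0 uG uF GN.
pose C := 1 + \sum_j \sum_i invmx G i j ^+ 2.
have C0 : 0 < C.
  by rewrite ltr_pwDl // sumr_ge0 // => j _; rewrite sumr_ge0 // => i _; exact: sqr_ge0.
pose s := (N * Num.sqrt C)^-1.
have s0 : 0 < s by rewrite invr_gt0 mulr_gt0 ?sqrtr_gt0.
apply: (@lt_le_trans _ _ (s / 3)%:E); first by rewrite lte_fin divr_gt0.
apply: (e_ran_lower inhD F n u FBD uF k s kn (ltW s0)) => a.
rewrite exprVn exprMn sqr_sqrtr ?(ltW C0) // ler_pdivrMl ?mulr_gt0 ?exprn_gt0 //.
rewrite mulrAC; apply: (@le_trans _ _ (sqn n.+1 (a *m G) * C)); last first.
  by apply: ler_wpM2r (GN a); exact: ltW.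
rewrite -{1}(mulmxK uG a) /C mulrDr mulr1 ler_wpDl ?sqn_ge0 //.
exact: sqn_mul.
Qed.

Lemma prod_half n (f : nat -> R) :
  \prod_(l < n.*2) f l./2 = (\prod_(k < n) f k) ^+ 2.
Proof.
elim: n => [|n IH]; first by rewrite !big_ord0 expr1n.
rewrite doubleS !big_ord_recr /= IH uphalf_double doubleK exprMn -mulrA.
by rewrite expr2.
Qed.

(** The determinant bound is applied with [E k] equal to [1 + e] times the k-th error, which is a
    strict upper bound because the errors are positive. Each index [k] occurs twice, so the root of
    order [2 * n] produces the geometric mean; finally [e] tends to 0. *)
Lemma le_poweR_e_ran n (N t : R) (u : 'I_n.*2 -> D -> R) (G : 'M[R]_n.*2) :
  (0 < n)%N -> 0 < N -> 0 < t ->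
  (forall a, sqn n.*2 a <= 1 -> F (lc n.*2 u a)) ->
  (forall a, sqn n.*2 (a *m G) <= N ^+ 2 * supnorm (lc n.*2 u a) ^+ 2) ->
  t ^+ n.*2 <= `|\det G| ->
  (t%:E <= (3 * N)%:E * ((\prod_(k < n) e_ran F k) `^ (n%:R^-1)))%E.
Proof.
move=> n0 N0 t0 uF uG tG.
have e0 (k : 'I_n) : (0 < e_ran F k)%E.
  case: n n0 k u G uF uG tG => // n _ k u G uF uG tG.
  have kn : (2 * k <= n.+1.*2)%N by rewrite mul2n leq_double ltnW.
  apply: (e_ran_gt0 _ k N u G kn) => //.
  by rewrite unitmxE unitfE -normr_gt0; apply: lt_le_trans tG; rewrite exprn_gt0.
have N30 : 0 < 3 * N by rewrite mulr_gt0.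
have ninv : (n%:R^-1 : R) != 0 by rewrite invr_eq0 pnatr_eq0 -lt0n.
(* If one error is infinite, so is the product, since the other factors are positive and a product
   of 0 and infinity cannot arise. *)
have [allfin|/forallPn[k]] := boolP [forall k : 'I_n, e_ran F k \is a fin_num]; last first.
  rewrite ge0_fin_numE ?e_ran_ge0 // -leNgt leye_eq => /eqP ek.
  rewrite (bigD1 k) //= ek gt0_mulye; last first.
    by apply: (big_ind (fun z : \bar R => (0 < z)%E)) => // x y; exact: mule_gt0.
  by rewrite poweRyr ?gt0_muley ?leey ?lte_fin.
pose x k := fine (e_ran F k).
have xE (k : 'I_n) : e_ran F k = (x k)%:E by rewrite fineK // (forallP allfin).
have x0 (k : 'I_n) : 0 < x k by rewrite -lte_fin -xE.
under eq_bigr do rewrite xE.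
rewrite prodEFin poweR_EFin -EFinM lee_fin.
set p := \prod_(k < n) x k.
have p0 : 0 < p by apply: prodr_gt0.
set X := 3 * N * p `^ n%:R^-1.
have X0 : 0 < X by rewrite mulr_gt0 // powR_gt0.
have pn : (p `^ n%:R^-1) ^+ n = p.
  by rewrite -powR_mulrn ?powR_ge0 // -powRrM mulVf ?powRr1 ?ltW // pnatr_eq0 -lt0n.
have tX e : 0 < e -> t <= X * (1 + e).
  move=> e_gt0.
  have eE k : (k < n)%N -> (e_ran F k < (x k * (1 + e))%:E)%E.
    move=> kn; have := x0 (Ordinal kn); have := xE (Ordinal kn); rewrite /= => -> xk.
    by rewrite lte_fin ltr_pMr ?ltrDl.
  have H := le_trans tG (det_le_prod_e_ran n N _ N0 eE _ u G (leqnn _) uF uG).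
  rewrite -(@ler_pXn2r _ n.*2) ?nnegrE ?(ltW t0) ?double_gt0 //; last first.
    by rewrite mulr_ge0 ?addr_ge0 ?ltW.
  apply: le_trans H _.
  rewrite (prod_half n (fun k => 3 * N * (x k * (1 + e)))) -muln2 exprM.
  rewrite !big_split /= !prodr_const card_ord -/p /X !exprMn pn.
  by rewrite le_eqVlt; apply/orP; left; apply/eqP; ring.
rewrite leNgt; apply/negP => Xt.
(* With this [e], [X * (1 + e)] is the midpoint of [X] and [t]. *)
have e_gt0 : 0 < (t - X) / 2 / X by rewrite !divr_gt0 ?subr_gt0.
have := tX _ e_gt0; rewrite mulrDr mulr1 mulrCA divff ?gt_eqF // mulr1; lra.
Qed.

End Elimination.

(** * Linear sampling algorithms *)

Section Sampling.
Context {R : realType} {D : Type}.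
Hypothesis inhD : inhabited D.

(** The part of linearity that convex combinations and sign changes involve. It is satisfied by
    point evaluations and inherited by combinations of them. *)
Definition affine_odd (A : (D -> R) -> R) :=
  (forall f g t, A (fun x => t * f x + (1 - t) * g x) = t * A f + (1 - t) * A g) /\
  (forall f, A (fun x => - f x) = - A f).

(* One-dimensional Hahn-Banach step: the admissible values of [a] form an
   interval, nonempty by convexity. *)
Lemma extend_bound (F : set (D -> R)) (A B : (D -> R) -> R) t :
  convexF F -> symmetricF F -> affine_odd A -> affine_odd B ->
  (forall f, F f -> B f = 0 -> `|A f| <= t) ->
  exists a, forall f, F f -> `|A f - a * B f| <= t.
Proof.
move=> cF sF [Ac An] [Bc Bn] AB.
have [[f0 [Ff0 Bf0]]|nB] := pselect (exists f, F f /\ 0 < B f); last first.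
  exists 0 => f Ff; rewrite mul0r subr0; apply: AB => //.
  apply/eqP; rewrite eq_le; apply/andP; split; rewrite leNgt; apply/negP => Bf.
    by apply: nB; exists f.
  apply: nB; exists (fun x => - f x); split; first exact: sF.
  by rewrite Bn oppr_gt0.
pose S := [set r | exists f, [/\ F f, 0 < B f & r = (A f - t) / B f]].
have SP f g : F f -> 0 < B f -> F g -> 0 < B g -> (A f - t) / B f <= (A g + t) / B g.
  move=> Ff Bf Fg Bg.
  have Bfg : 0 < B f + B g by rewrite addr_gt0.
  (* The weights are chosen so that [B] vanishes on the convex combination of [f] and [- g]. *)
  pose l := B g / (B f + B g).
  have l1 : 1 - l = B f / (B f + B g).
    by rewrite /l; field; rewrite gt_eqF.
  have l01 : 0 <= l <= 1.
    by rewrite -[l <= 1]subr_ge0 l1 !divr_ge0 // ltW.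
  have Fh := cF f _ l Ff (sF _ Fg) l01.
  have Bh : B (fun x => l * f x + (1 - l) * - g x) = 0.
    by rewrite Bc Bn l1 /l; field; rewrite gt_eqF.
  have := le_trans (ler_norm _) (AB _ Fh Bh).
  rewrite Ac An l1 /l => H.
  rewrite ler_pdivrMr // mulrAC ler_pdivlMr //.
  have {}H : B g * A f - B f * A g <= t * (B f + B g).
    rewrite -ler_pdivrMr // (_ : _ / _ = B g / (B f + B g) * A f + B f / (B f + B g) * - A g) //.
    by field; rewrite gt_eqF.
  lra.
have supS g : F g -> 0 < B g -> sup S <= (A g + t) / B g.
  move=> Fg Bg; apply: ge_sup; first by exists ((A f0 - t) / B f0), f0.
  by move=> _ [f [Ff Bf ->]]; exact: SP.
have hsS : has_ubound S.
  by exists ((A f0 + t) / B f0) => _ [f [Ff Bf ->]]; exact: SP.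
have pos f : F f -> 0 < B f -> `|A f - sup S * B f| <= t.
  move=> Ff Bf; have H1 := supS f Ff Bf.
  have H2 : (A f - t) / B f <= sup S by apply: ub_le_sup => //; exists f.
  move: H1 H2; rewrite ler_pdivlMr // ler_pdivrMr // => H1 H2.
  by rewrite ler_norml; lra.
exists (sup S) => f Ff; have [Bf|Bf|Bf] := ltrgtP (B f) 0; last first.
- by rewrite Bf mulr0 subr0; exact: AB.
- exact: pos.
- have := pos _ (sF _ Ff); rewrite Bn An oppr_gt0 => /(_ Bf).
  by rewrite mulrN -opprD normrN.
Qed.

Lemma affine_odd_sub p (A : (D -> R) -> R) (l : 'I_p -> (D -> R) -> R) (a : 'I_p -> R) :
  affine_odd A -> (forall i, affine_odd (l i)) ->
  affine_odd (fun f => A f - \sum_i a i * l i f).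
Proof.
move=> [Ac An] hl; split => [f g t|f].
  rewrite Ac; under eq_bigr => i _ do rewrite (hl i).1 mulrDr mulrCA [X in _ + X]mulrCA.
  by rewrite big_split /= -!mulr_sumr; ring.
rewrite An; under eq_bigr => i _ do rewrite (hl i).2 mulrN.
by rewrite sumrN; ring.
Qed.

(** The induction hypothesis is used on the part of [F] where [l ord0] vanishes, which is again
    convex and symmetric; [extend_bound] then supplies the coefficient of [l ord0]. *)
Lemma extend_bounds p (F : set (D -> R)) (A : (D -> R) -> R) (l : 'I_p -> (D -> R) -> R) t :
  convexF F -> symmetricF F -> affine_odd A -> (forall i, affine_odd (l i)) ->
  (forall f, F f -> (forall i, l i f = 0) -> `|A f| <= t) ->
  exists a : 'I_p -> R, forall f, F f -> `|A f - \sum_i a i * l i f| <= t.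
Proof.
elim: p F l => [|p IH] F l cF sF hA hl Al.
  by exists (fun=> 0) => f Ff; rewrite big_ord0 subr0; apply: Al => // -[].
pose G := [set f | F f /\ l ord0 f = 0].
have cG : convexF G.
  move=> f g s [Ff lf] [Fg lg] s01; split; first exact: cF.
  by rewrite (hl ord0).1 lf lg !mulr0 addr0.
have sG : symmetricF G.
  by move=> f [Ff lf]; split; [exact: sF | rewrite (hl ord0).2 lf oppr0].
have [a ha] := IH G (fun i => l (lift ord0 i)) cG sG hA (fun i => hl _)
  (fun f Gf lf => Al f Gf.1 (fun i => match unliftP ord0 i with
     | UnliftSome j e => etrans (congr1 (l^~ f) e) (lf j)
     | UnliftNone e => etrans (congr1 (l^~ f) e) Gf.2 end)).
have [b hb] := extend_bound F (fun f => A f - \sum_i a i * l (lift ord0 i) f) (l ord0) t cF sF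
  (affine_odd_sub _ _ _ _ hA (fun i => hl _)) (hl ord0) (fun f Ff lf => ha f (conj Ff lf)).
exists (fun i => if unlift ord0 i is Some j then a j else b) => f Ff.
rewrite big_ord_recl unlift_none; under eq_bigr do rewrite liftK.
by rewrite opprD addrCA addrC; have := hb f Ff; rewrite [_ + - _]addrC.
Qed.

Variable F : set (D -> R).
Hypothesis FBD : F `<=` @BD R D.
Hypothesis cF : convexF F.
Hypothesis sF : symmetricF F.

Lemma det_triangular p (x : nat -> D) (fs : nat -> D -> R) :
  (forall i j, (j < i)%N -> (i < p)%N -> fs i (x j) = 0) ->
  \det (\matrix_(i < p, j < p) fs i (x j)) = \prod_(i < p) fs i (x i).
Proof.
move=> tri; rewrite -det_tr det_trig.
  by apply: eq_bigr => i _; rewrite !mxE.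
by apply/is_trig_mxP => i j ij; rewrite !mxE tri.
Qed.

(** For each [y], [extend_bounds] approximates evaluation at [y] by the samples up to error [t]. The
    coefficients are bounded in [y] because applying the approximation to the [fs i] gives functions
    within [t] of them, and the triangular matrix of samples can be inverted. *)
Lemma g_lin_le p N (x : nat -> D) (fs : nat -> D -> R) t : (p <= N)%N ->
  (forall i, (i < p)%N -> F (fs i)) ->
  (forall i j, (j < i)%N -> (i < p)%N -> fs i (x j) = 0) ->
  (forall i, (i < p)%N -> fs i (x i) != 0) ->
  0 <= t ->
  (forall f, F f -> (forall i, (i < p)%N -> f (x i) = 0) -> forall y, `|f y| <= t) ->
  (g_lin F N <= t%:E)%E.
Proof.
move=> pN Ffs tri diag t0 Ft.
have eval y : affine_odd (fun f : D -> R => f y) by [].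
have /choice[a ha] : forall y, exists a : 'I_p -> R,
    forall f, F f -> `|f y - \sum_i a i * f (x i)| <= t.
  move=> y; apply: (extend_bounds p F (fun f => f y) (fun i f => f (x i))) => // f Ff fx.
  by apply: Ft => // i ip; exact: (fx (Ordinal ip)).
pose M := \matrix_(i < p, j < p) fs i (x j).
have Mu : M \in unitmx.
  by rewrite unitmxE /M (det_triangular p x fs tri) unitfE prodf_seq_neq0; apply/allP => i _; exact: diag.
pose b i y := \sum_(j < p) a y j * fs i (x j).
have bb (i : 'I_p) : BD (b i).
  have [K fK] := FBD _ (Ffs i (ltn_ord i)); exists (K + t) => y.
  rewrite (_ : b i y = fs i y - (fs i y - b i y)); last by ring.
  by apply: (le_trans (ler_normB _ _)); apply: lerD => //; exact/ha/Ffs.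
have ba j : BD (a^~ j).
  rewrite (_ : a^~ j = fun y => \sum_(i < p) invmx M j i * b i y).
    by apply: BD_sum => i; exact: BDZ.
  apply/funext => y.
  transitivity ((invmx M *m (M *m \col_k a y k)) j 0); first by rewrite mulKmx // mxE.
  rewrite mxE; apply: eq_bigr => i _; congr (_ * _).
  by rewrite mxE; apply: eq_bigr => k _; rewrite !mxE mulrC.
(* Padding by zero functions uses up the remaining [N - p] samples. *)
pose phi (i : nat) y := if insub i is Some j then a y j else 0 : R.
apply: (@le_trans _ _ (wc_err F (fun f =>
    (supnorm (fun y => f y - \sum_(i < N) f (x i) * phi i y))%:E))).
  apply: ereal_inf_lbound; exists (fun i => x i), (fun i => phi i); split => // i.
  rewrite /phi; case: insubP => [j _ _|_]; [exact: ba | exact: BD0].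
apply: ge_ereal_sup => _ [->|[f Ff <-]]; rewrite ?lee_fin //.
apply: supnorm_le => // y.
have -> : \sum_(i < N) f (x i) * phi i y = \sum_(i < p) a y i * f (x i).
  rewrite (bigID (fun i : 'I_N => (i < p)%N)) /= [X in _ + X]big1 ?addr0; last first.
    by move=> i /negbTE ip; rewrite /phi insubF // mulr0.
  rewrite -(big_ord_widen _ (fun i => f (x i) * phi i y)) //.
  by apply: eq_bigr => i _; rewrite /phi valK mulrC.
exact: ha.
Qed.

(** For [c = 0] the last clause only says that [f y] is nonnegative. For [c] close to 1 the pair
    [f], [y] almost attains the largest value among functions of [F] that vanish at the previous
    points. *)
Definition near_max (c t : R) (x : nat -> D) (i : nat) (f : D -> R) (y : D) :=
  [/\ F f, forall j, (j < i)%N -> f (x j) = 0, t <= f y &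
    forall g, F g -> (forall j, (j < i)%N -> g (x j) = 0) -> forall z, c * `|g z| <= f y].

(** As long as [p <= N] points are chosen, some function of [F] vanishing there exceeds [t] in
    absolute value, since otherwise [g_lin_le] would give [g_lin F N <= t]. Hence [N + 1] functions
    can be found. *)
Lemma triangular_system N (c t : R) : 0 < t -> (t%:E < g_lin F N)%E -> 0 <= c < 1 ->
  c = 0 \/ (exists K, forall f, F f -> forall x, `|f x| <= K) ->
  forall p, (p <= N.+1)%N -> exists (x : nat -> D) (fs : nat -> D -> R),
    forall i, (i < p)%N -> near_max c t x i (fs i) (x i).
Proof.
move=> t0 tg /andP[c0 c1] cK; elim=> [|p IH] pN.
  by case: inhD => x0; exists (fun=> x0), (fun=> fun=> 0).
have [x [fs sys]] := IH (ltnW pN).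
have [f [y [Ff fx fy]]] : exists f y,
    [/\ F f, forall i, (i < p)%N -> f (x i) = 0 & t < `|f y|].
  apply: contrapT => H; move: tg; apply/negP; rewrite -leNgt.
  apply: (g_lin_le p N x fs t) => //; last 2 first.
  - exact: ltW.
  - move=> f Ff fx y; rewrite leNgt; apply/negP => fy.
    by apply: H; exists f, y.
  - by move=> i /sys[].
  - by move=> i j ji /sys[_ + _ _]; apply.
  - by move=> i /sys[_ _ ti _]; rewrite gt_eqF // (lt_le_trans t0).
pose V := [set r | exists g z, [/\ F g, forall i, (i < p)%N -> g (x i) = 0 & r = `|g z|]].
have [g [z [Fg gx tgz gmax]]] : exists g z, [/\ F g, forall i, (i < p)%N -> g (x i) = 0,
    t <= `|g z| & forall r, V r -> c * r <= `|g z|].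
  case: cK => [->|[K FK]].
    by exists f, y; split => // [|r _]; [exact: ltW | rewrite mul0r].
  have hsV : has_sup V.
    split; first by exists `|f y|, f, y.
    by exists K => _ [g [z [Fg _ ->]]]; exact: FK.
  have Vf : `|f y| <= sup V by apply: ub_le_sup; [exact: hsV.2 | exists f, y].
  have S0 : 0 < sup V by apply: lt_le_trans Vf; exact: lt_trans fy.
  (* Both requirements lie strictly below [sup V], the first because of [f] and the second because
     [c < 1], so one element of [V] meets them together. *)
  pose m := Num.max t (c * sup V).
  have mS : m < sup V.
    by rewrite gt_max (lt_le_trans fy Vf) /= gtr_pMl.
  have e0 : 0 < sup V - m by rewrite subr_gt0.
  have [_ [g [z [Fg gx ->]]]] := sup_adherent e0 hsV.
  rewrite opprB addrC subrK gt_max => /andP[tgz cgz].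
  exists g, z; split => // [|r Vr]; first exact: ltW.
  apply: le_trans (ltW cgz); rewrite ler_wpM2l //.
  exact: (sup_upper_bound hsV).
have [h [Fh hx hz]] : exists h, [/\ F h, forall i, (i < p)%N -> h (x i) = 0 & h z = `|g z|].
  have [g0|g0] := lerP 0 (g z); first by exists g; split; rewrite ?ger0_norm.
  exists (fun x => - g x); split; [exact: sF | by move=> i /gx ->; rewrite oppr0 |].
  by rewrite ltr0_norm.
exists (fun k => if k == p then z else x k), (fun k => if k == p then h else fs k) => i.
have xE j : (j < i <= p)%N -> (if j == p then z else x j) = x j.
  by move=> /andP[ji ip]; rewrite ifN // neq_ltn (leq_trans ji ip).
rewrite ltnS leq_eqVlt => /predU1P[ip|ip].
  rewrite ip eqxx in xE *; split => //.
  - by move=> j jp; rewrite xE ?jp ?leqnn //; exact: hx.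
  - by rewrite hz.
  - move=> k Fk kx w; rewrite hz; apply: gmax; exists k, w; split => // j jp.
    by rewrite -(kx j jp) xE // jp leqnn.
rewrite (ltn_eqF ip); have [F1 F2 F3 F4] := sys i ip; split => //.
- by move=> j ji; rewrite xE ?F2 // ji ltnW.
- by move=> k Fk kx w; apply: F4 => // j ji; rewrite -(kx j ji) xE // ji ltnW.
Qed.

(** The first term is split off with weight [|b ord0|], its sign being absorbed by symmetry, and the
    rest is rescaled by [1 - |b ord0|]. *)
Lemma F_abs_convex p (b : 'I_p -> R) (fs : 'I_p -> D -> R) : F (fun=> 0) ->
  (forall i, F (fs i)) -> \sum_i `|b i| <= 1 -> F (fun x => \sum_i b i * fs i x).
Proof.
move=> F0; elim: p b fs => [|p IH] b fs Ffs b1.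
  by under eq_fun do rewrite big_ord0.
rewrite big_ord_recl in b1.
set be := `|b ord0| in b1.
set r := \sum_(i < p) _ in b1.
have r0 : 0 <= r by apply: sumr_ge0.
have be0 : 0 <= be by exact: normr_ge0.
(* If [be = 1], then [g] is 0 by division by 0, and the other [b i] vanish. *)
pose g x := \sum_(i < p) (b (lift ord0 i) / (1 - be)) * fs (lift ord0 i) x.
have Fg : F g.
  apply: IH => // ; under eq_bigr do rewrite normrM.
  rewrite -mulr_suml -/r normfV ger0_norm; last by lra.
  have [->|be1] := eqVneq (1 - be) 0; first by rewrite invr0 mulr0.
  by rewrite ler_pdivrMr ?mul1r ?lt_def ?be1 /=; lra.
have [h Fh hE] : exists2 h, F h & forall x, be * h x = b ord0 * fs ord0 x.
  rewrite /be; have [b0|b0] := lerP 0 (b ord0); first by exists (fs ord0) => // x; rewrite ger0_norm.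
  by exists (fun x => - fs ord0 x); [exact: sF | move=> x; rewrite ltr0_norm // mulrNN].
have := cF h g be Fh Fg; rewrite be0 /=.
have -> : be <= 1 by lra.
move=> /(_ isT); congr (F _); apply/funext => x; rewrite hE big_ord_recl; congr (_ + _).
rewrite mulr_sumr; apply: eq_bigr => i _.
have [be1|be1] := eqVneq (1 - be) 0; last by rewrite mulrA mulrCA divff // mulr1.
have rz : r = 0 by lra.
have /(_ i isT) /eqP := psumr_eq0P (fun j _ => normr_ge0 (b (lift ord0 j))) rz.
by rewrite normr_eq0 => /eqP ->; rewrite !mul0r mulr0.
Qed.

Lemma sqr_sum_le p (a : 'rV[R]_p) : (\sum_i `|a 0 i|) ^+ 2 <= p%:R * sqn p a.
Proof.
have := @cauchy_schwarz_sum R p (fun=> 1) (fun i => `|a 0 i|).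
under eq_bigr do rewrite mul1r.
under [X in _ <= X * _ -> _]eq_bigr do rewrite expr1n.
rewrite sumr_const card_ord => H; apply: (le_trans H).
by apply: ler_wpM2l => //; apply: ler_sum => i _; rewrite real_normK ?num_real.
Qed.

(** The j-th entry of the product is [k] times the value of the scaled combination at [x j], so each
    of the [p] squares is controlled by the sup-norm. *)
Lemma sqn_mul_eval p (k : R) (x : nat -> D) (fs : nat -> D -> R) (a : 'rV[R]_p) :
  0 < k -> (forall i, (i < p)%N -> F (fs i)) ->
  sqn p (a *m \matrix_(i < p, j < p) fs i (x j)) <=
  (p%:R * k ^+ 2) * supnorm (lc p (fun i y => k^-1 * fs i y) a) ^+ 2.
Proof.
move=> k0 Ffs; set l := lc _ _ _.
have bl : BD l by apply: BD_lc => i; apply: BDZ; exact/FBD/Ffs.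
rewrite [leRHS](_ : _ = \sum_(j < p) (k * supnorm l) ^+ 2); last first.
  by rewrite sumr_const card_ord -[RHS]mulr_natl; ring.
apply: ler_sum => j _.
have -> : (a *m \matrix_(i < p, j < p) fs i (x j)) 0 j = k * l (x j).
  rewrite mxE /l /lc mulr_sumr; apply: eq_bigr => i _.
  by rewrite mxE [RHS]mulrCA (mulrA k) divff ?gt_eqF // mul1r.
rewrite -real_normK ?num_real // ler_pXn2r ?nnegrE ?mulr_ge0 ?supnorm_ge0 ?(ltW k0) //.
by rewrite normrM gtr0_norm // ler_pM2l // le_supnorm.
Qed.

Lemma le_of_all_lt (g r : \bar R) : (0 <= r)%E ->
  (forall t : R, 0 < t -> (t%:E < g)%E -> (t%:E <= r)%E) -> (g <= r)%E.
Proof.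
case: r => [r|_ _|//]; last by rewrite leey.
rewrite lee_fin => r0 H; rewrite leNgt; apply/negP; case: g H => [g| |//] H rg.
  rewrite lte_fin in rg; have m0 : 0 < (r + g) / 2 by lra.
  have := H _ m0; rewrite lte_fin lee_fin => /(_ ltac:(lra)); lra.
have := H (r + 1); rewrite ltry lee_fin; have r1 : 0 < r + 1 by lra.
by move=> /(_ r1 isT); lra.
Qed.

Lemma mule_poweR_e_ran_ge0 n (K : R) : 0 <= K ->
  (0 <= K%:E * ((\prod_(k < n) e_ran F k) `^ (n%:R^-1)))%E.
Proof. by move=> K0; rewrite mule_ge0 ?lee_fin ?poweR_ge0. Qed.

Lemma pow_le_det p t (x : nat -> D) (fs : nat -> D -> R) c : 0 < t ->
  (forall i, (i < p)%N -> near_max c t x i (fs i) (x i)) ->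
  t ^+ p <= `|\det (\matrix_(i < p, j < p) fs i (x j))|.
Proof.
move=> t0 sys; rewrite (det_triangular p x fs); last by move=> i j ji /sys[_ + _ _]; apply.
apply: le_trans (ler_norm _); rewrite -[X in t ^+ X]card_ord -prodr_const.
apply: ler_prod => i _; rewrite (ltW t0) /=.
by have [] := sys i (ltn_ord i).
Qed.

(** With [2 * n] functions, coefficients in the Euclidean unit ball have absolute sum at most [k],
    the root of [2 * n]; dividing the functions by [k] keeps the combinations in [F]. Then
    [N ^+ 2 = 2 * n * k ^+ 2], so [N = 2 * n] and [3 * N = 6 * n]. *)
Lemma g_lin_convex n : (0 < n)%N ->
  (g_lin F (2 * n - 1) <=
     (6 * n%:R)%:E * ((\prod_(k < n) e_ran F k) `^ (n%:R^-1)))%E.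
Proof.
move=> n0; apply: le_of_all_lt => [|t t0 tg]; first by apply: mule_poweR_e_ran_ge0; rewrite mulr_ge0.
have pN : (n.*2 <= (2 * n - 1).+1)%N by lia.
have [|x [fs sys]] := triangular_system _ 0 t t0 tg _ (or_introl erefl) _ pN.
  by rewrite lexx ltr01.
have Ffs i : (i < n.*2)%N -> F (fs i) by move=> /sys[].
have F0 : F (fun=> 0).
  have F1 : F (fs 0%N) by apply: Ffs; rewrite double_gt0.
  (* The zero function is the midpoint of [fs 0] and its negative. *)
  have := cF _ _ 2^-1 F1 (sF _ F1); rewrite (_ : 0 <= 2^-1 <= 1); last by lra.
  by move=> /(_ isT); congr (F _); apply/funext => y; field.
pose k : R := Num.sqrt (n.*2)%:R.
have m0 : 0 < (n.*2)%:R :> R by rewrite ltr0n double_gt0.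
have k0 : 0 < k by rewrite sqrtr_gt0.
have k2 : k ^+ 2 = (n.*2)%:R by rewrite sqr_sqrtr ?ltW.
rewrite (_ : 6 * n%:R = 3 * (n.*2)%:R); last first.
  by rewrite -muln2 natrM; ring.
apply: (le_poweR_e_ran inhD F FBD n _ t (fun i y => k^-1 * fs i y)
   (\matrix_(i, j) fs i (x j))) => // [a a1|a|].
- rewrite (_ : lc _ _ _ = fun y => \sum_(i < n.*2) (a 0 i / k) * fs i y); last first.
    by apply/funext => y; apply: eq_bigr => i _; rewrite mulrA.
  apply: F_abs_convex => //; first by move=> i; exact: Ffs.
  under eq_bigr do rewrite normrM.
  rewrite -mulr_suml normfV gtr0_norm // ler_pdivrMr // mul1r.
  rewrite -(@ler_pXn2r _ 2) ?nnegrE ?(ltW k0) ?sumr_ge0 // k2.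
  by apply: (le_trans (sqr_sum_le _ a)); rewrite ler_piMr // ltW.
- by apply: (le_trans (sqn_mul_eval _ k x fs a k0 Ffs)); rewrite k2 -expr2.
- exact: pow_le_det sys.
Qed.

End Sampling.

(** * Unit balls of Hilbert spaces *)

Section Hilbert.
Context {R : realType} {D : Type}.
Hypothesis inhD : inhabited D.
Variables (H : set (D -> R)) (ip : (D -> R) -> (D -> R) -> R).
Hypothesis hH : hilbert_emb H ip.

Lemma hilbert_lc p (b : 'I_p -> R) (fs : 'I_p -> D -> R) : (forall i, H (fs i)) ->
  H (fun x => \sum_i b i * fs i x) /\
  forall h, H h -> ip (fun x => \sum_i b i * fs i x) h = \sum_i b i * ip (fs i) h.
Proof.
have [H0 [Hlin [_ [_ [iplin _]]]]] := hH.
elim: p b fs => [|p IH] b fs Hfs.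
  under eq_fun do rewrite big_ord0; split => // h Hh.
  have := iplin 1 _ _ h H0 H0 Hh.
  by under eq_fun do rewrite mulr0 addr0; rewrite mul1r big_ord0; lra.
have [HS ipS] := IH (fun i => b (lift ord0 i)) (fun i => fs (lift ord0 i)) (fun i => Hfs _).
under eq_fun do rewrite big_ord_recl; split; first exact: Hlin.
by move=> h Hh; rewrite iplin // big_ord_recl ipS.
Qed.

(** Put [h = fs l - B * fs i] with [B] the inner product. As [fs i] vanishes at the points up to
    [x l], [h] competes with [fs l] and has the same value at [x l]. Normalizing [h] and using
    near-maximality gives [c ^+ 2 <= ip h h], while [ip h h <= 1 - B ^+ 2]. *)
Lemma near_max_orth (c t : R) (x : nat -> D) (fs : nat -> D -> R) p i l :
  0 <= c -> 0 < t ->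
  (forall i, (i < p)%N -> near_max [set f | H f /\ ip f f <= 1] c t x i (fs i) (x i)) ->
  (l < i)%N -> (i < p)%N -> ip (fs l) (fs i) ^+ 2 <= 1 - c ^+ 2.
Proof.
have [_ [Hlin [_ [ipC [iplin [ip0 [ipdef _]]]]]]] := hH.
move=> c0 t0 sys li ip_.
have [[Hi i1] ix ti _] := sys i ip_.
have [[Hl l1] lx tl lmax] := sys l (ltn_trans li ip_).
set B := ip (fs l) (fs i).
pose h y := (- B) * fs i y + fs l y.
have Hh : H h by exact: Hlin.
have hx : h (x l) = fs l (x l) by rewrite /h ix // mulr0 add0r.
have hv j : (j < l)%N -> h (x j) = 0.
  by move=> jl; rewrite /h ix ?(ltn_trans jl) // lx // mulr0 add0r.
have hh : ip h h = B ^+ 2 * ip (fs i) (fs i) - 2 * B ^+ 2 + ip (fs l) (fs l).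
  rewrite iplin // (ipC (fs i) h) // (ipC (fs l) h) // !iplin // (ipC (fs i) (fs l)) //.
  by rewrite -/B; ring.
suff : c ^+ 2 <= ip h h.
  rewrite hh => K; have : B ^+ 2 * ip (fs i) (fs i) <= B ^+ 2 by rewrite ler_piMr ?sqr_ge0.
  lra.
(* [h] is nonzero because its value at [x l] is at least [t]. *)
have q0 : 0 < ip h h.
  rewrite lt_def ip0 // andbT; apply/eqP => hh0.
  by have := congr1 (fun f => f (x l)) (ipdef h Hh hh0); rewrite hx; lra.
pose s := Num.sqrt (ip h h).
have s0 : 0 < s by rewrite sqrtr_gt0.
have s2 : s ^+ 2 = ip h h by rewrite sqr_sqrtr ?ltW.
have H0 : H (fun=> 0) by have [] := hH.
have Hg : H (fun y => s^-1 * h y).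
  by have := Hlin s^-1 h _ Hh H0; under eq_fun do rewrite addr0.
have gg : ip (fun y => s^-1 * h y) (fun y => s^-1 * h y) = 1.
  have ipZ f : H f -> ip (fun y => s^-1 * h y) f = s^-1 * ip h f.
    move=> Hf; have := iplin s^-1 h (fun=> 0) f Hh H0 Hf.
    under eq_fun do rewrite addr0.
    move=> ->.
    have := iplin 1 _ _ f H0 H0 Hf.
    by under eq_fun do rewrite mulr0 addr0; rewrite mul1r => ?; lra.
  by rewrite ipZ // ipC // ipZ // -s2; field; rewrite gt_eqF.
have lx0 : 0 < fs l (x l) by exact: lt_le_trans tl.
have gv j : (j < l)%N -> s^-1 * h (x j) = 0 by move=> jl; rewrite hv // mulr0.
have Fg : [set f | H f /\ ip f f <= 1] (fun y => s^-1 * h y) by split; rewrite ?gg.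
have := lmax _ Fg gv (x l); rewrite hx.
rewrite gtr0_norm ?mulr_gt0 ?invr_gt0 // mulrA ger_pMl //.
rewrite ler_pdivrMr // mul1r => K.
by rewrite -s2 ler_pXn2r ?nnegrE // ltW.
Qed.

Let F := [set f | H f /\ ip f f <= 1].
Hypothesis cF : convexF F.
Hypothesis sF : symmetricF F.

(** Almost orthogonality lets the functions be divided by the root of 2 instead of the root of
    [2 * n]. Then [N ^+ 2 = 2 * n * 2], so [3 * N] is 6 times the root of [n]. *)
Lemma g_lin_hilbert n : (0 < n)%N ->
  (g_lin F (4 * n - 1) <=
     (6 * Num.sqrt n%:R)%:E * ((\prod_(k < n) e_ran F k) `^ (n%:R^-1)))%E.
Proof.
have [H0 [Hlin [HBD [ipC [iplin [ip0 [ipdef [_ [C HC]]]]]]]]] := hH.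
have FBD : F `<=` @BD R D by move=> f [/HBD].
have FC : exists K, forall f, F f -> forall x, `|f x| <= K.
  exists `|C| => f [Hf f1] x.
  apply: le_trans (le_supnorm f x (HBD f Hf)) _.
  apply: le_trans (HC f Hf) _; apply: (le_trans (ler_norm _)).
  rewrite normrM ler_piMr // ger0_norm ?sqrtr_ge0 //.
  by rewrite -sqrtr1 ler_wsqrtr.
move=> n0; apply: le_of_all_lt => [|t t0 tg].
  by apply: mule_poweR_e_ran_ge0; rewrite mulr_ge0 ?sqrtr_ge0.
have pN : (n.*2 <= (4 * n - 1).+1)%N by lia.
have m0 : 0 < (n.*2)%:R :> R by rewrite ltr0n double_gt0.
have m1 : 1 <= (n.*2)%:R :> R by rewrite ler1n double_gt0.
set m : R := (n.*2)%:R in m0 m1.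
(* With [c = 1 - eta] the squared inner products are at most [2 * eta], which is the square of
   [m^-1]. *)
pose eta : R := (2 * m ^+ 2)^-1.
have eta0 : 0 < eta by rewrite invr_gt0 mulr_gt0 // exprn_gt0.
have eta1 : eta <= 2^-1.
  by rewrite lef_pV2 ?posrE ?mulr_gt0 ?exprn_gt0 // ler_pMr // exprn_ege1.
have [|x [fs sys]] := triangular_system inhD F FBD cF sF _ (1 - eta) t t0 tg _ (or_intror FC) _ pN.
  by apply/andP; split; lra.
have Ffs i : (i < n.*2)%N -> F (fs i) by move=> /sys[].
have Hfs (i : 'I_n.*2) : H (fs i) by have [] := Ffs i (ltn_ord i).
have orth (i l : 'I_n.*2) : l != i -> `|ip (fs l) (fs i)| <= m^-1.
  wlog li : i l / (l < i)%N => [W|_].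
    rewrite -val_eqE neq_ltn => /orP[li|il]; first by apply: W => //; rewrite -val_eqE ltn_eqF.
    by rewrite ipC //; apply: W => //; rewrite -val_eqE ltn_eqF.
  rewrite -(@ler_pXn2r _ 2) ?nnegrE ?invr_ge0 ?(ltW m0) // real_normK ?num_real //.
  apply: le_trans (near_max_orth _ _ _ _ _ _ _ _ t0 sys li (ltn_ord i)) _; first lra.
  have -> : m^-1 ^+ 2 = 2 * eta by rewrite /eta; field; rewrite gt_eqF.
  have e2 := sqr_ge0 eta.
  have -> : (1 - eta) ^+ 2 = 1 - 2 * eta + eta ^+ 2 by ring.
  lra.
(* The diagonal of the Gram matrix contributes at most [sqn _ a]. The other entries are at most
   [m^-1], and by Cauchy-Schwarz the squared absolute sum of the [m] coefficients is at most
   [m * sqn _ a], so they contribute at most [sqn _ a] again. *)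
have ip_lc (a : 'rV[R]_n.*2) : ip (lc _ (fun i => fs i) a) (lc _ (fun i => fs i) a) <= 2 * sqn _ a.
  have [HL ipL] := hilbert_lc _ (fun i => a 0 i) (fun i => fs i) Hfs.
  rewrite -/(lc _ _ _) in HL ipL; rewrite ipL //.
  under eq_bigr => i _ do rewrite (ipC (fs i)) // ipL //.
  apply: (@le_trans _ _ (\sum_i (a 0 i ^+ 2 + \sum_j `|a 0 i| * (`|a 0 j| * m^-1)))).
    apply: ler_sum => i _; rewrite mulr_sumr (bigD1 i) //=; apply: lerD.
      rewrite mulrA -expr2 ler_piMr ?sqr_ge0 //; exact: (Ffs i (ltn_ord i)).2.
    rewrite [leRHS](bigD1 i) //= ler_wpDl ?mulr_ge0 ?invr_ge0 ?(ltW m0) //.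
    apply: ler_sum => j ji; apply: (le_trans (ler_norm _)); rewrite !normrM.
    by rewrite !ler_wpM2l //; exact: orth.
  rewrite big_split /= mulr_natl mulr2n lerD //.
  under eq_bigr do rewrite -mulr_sumr -mulr_suml.
  rewrite -mulr_suml mulrA -expr2 ler_pdivrMr // mulrC.
  exact: sqr_sum_le.
pose k : R := Num.sqrt 2.
have k0 : 0 < k by rewrite sqrtr_gt0.
have k2 : k ^+ 2 = 2 by rewrite sqr_sqrtr.
rewrite (_ : 6 * Num.sqrt n%:R = 3 * Num.sqrt (m * 2)); last first.
  rewrite /m -muln2 natrM -mulrA -natrM (_ : (2 * 2)%:R = 2 ^+ 2 :> R); last by rewrite -natrX.
  by rewrite sqrtrM // sqrtr_sqr ger0_norm //; ring.
apply: (le_poweR_e_ran inhD F FBD n _ t (fun i y => k^-1 * fs i y)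
   (\matrix_(i, j) fs i (x j))) => // [|a a1|a|].
- by rewrite sqrtr_gt0 mulr_gt0.
- have -> : lc _ (fun i y => k^-1 * fs i y) a =
      lc _ (fun i => fs i) (k^-1 *: a).
    by apply/funext => y; apply: eq_bigr => i _; rewrite mxE mulrCA mulrA.
  split; first by have [] := hilbert_lc _ (fun i => (k^-1 *: a) 0 i) (fun i => fs i) Hfs.
  apply: le_trans (ip_lc _) _; rewrite sqnZ exprVn k2 mulrA divff ?mul1r //.
- apply: (le_trans (sqn_mul_eval F FBD _ k x fs a k0 Ffs)).
  by rewrite k2 -/m sqr_sqrtr ?mulr_ge0 // ltW.
- exact: pow_le_det sys.
Qed.

End Hilbert.

Theorem theorem2 (R : realType) (D : Type) (F : set (D -> R)) :
  inhabited D -> F `<=` @BD R D -> convexF F -> symmetricF F ->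
  forall n : nat, (0 < n)%N ->
    (g_lin F (2 * n - 1) <=
       (6 * n%:R)%:E * ((\prod_(k < n) e_ran F k) `^ (n%:R^-1)))%E /\
    (forall (H : set (D -> R)) (ip : (D -> R) -> (D -> R) -> R),
       hilbert_emb H ip -> F = [set f | H f /\ ip f f <= 1] ->
       (g_lin F (4 * n - 1) <=
          (6 * Num.sqrt n%:R)%:E * ((\prod_(k < n) e_ran F k) `^ (n%:R^-1)))%E).
Proof.
move=> inhD FBD cF sF n n0; split; first exact: g_lin_convex.
move=> H ip hH FE; move: cF sF; rewrite FE => cF sF.
exact: g_lin_hilbert.
Qed.
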